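(* Let $\gamma>0$. Let $I=[0,T]$ if $T$ is positive (and finite), or $I=[0,\infty)$ if $T=\infty$. Let $u_0\in C^2_b(\mathbf{R}^+)\cap H^2(\mathbf{R}^+)$ and $g\in C^1(I)$ with $u_0(0)=g(0)=0$. Then the solution of the initial- and boundary-value problem $$ \begin{cases} u_t-\gamma u_{xxt}=0, & x\ge 0,\ t\in I,\\ u(x,0)=u_0(x), & x\ge 0,\\ u(0,t)=g(t), & t\in I, \end{cases} $$ is given by $$ u(x,t)=u_0(x)+g(t)\,e^{-\frac{x}{\sqrt{\gamma}}}. $$
   Context: $\mathbf{R}^+=[0,\infty)$. $C_b^k(\mathbf{R}^+)$ is the space of $C^k$ functions on $\mathbf{R}^+$ which are bounded together with their first $k$ derivatives. Subscripts on $u$ denote partial derivatives. The solution is understood in the class $C(I;H^2(\mathbf{R}^+))$, in which the problem has a unique solution. *)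

(* Defs.v *)
From HB Require Import structures.
From mathcomp Require Import all_boot all_order all_algebra.
From mathcomp Require Import all_classical all_reals all_analysis.

Set Implicit Arguments.
Unset Strict Implicit.
Unset Printing Implicit Defensive.

Import Order.TTheory GRing.Theory Num.Theory.
Import numFieldNormedType.Exports.

Local Open Scope classical_set_scope.
Local Open Scope ring_scope.

(* A function on R^+ or on R^+ x I is represented by a total function on R or
   R x R; every definition below only looks at its values on R^+ or R^+ x I. *)

Definition Rplus (R : realType) : set R := [set x | 0 <= x].
Arguments Rplus : clear implicits.

(* [0, T] when T is finite, [0, +oo[ when T = +oo. *)
Definition time_interval (R : realType) (T : \bar R) : set R :=
  [set t | 0 <= t /\ (t%:E <= T)%E].

(* Derivative relative to A, hence one-sided at an end point of A. *)
Definition is_derive_within (R : realType) (A : set R) (f : R -> R) (x l : R) :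
    Prop :=
  (fun y => (f y - f x) / (y - x)) @ within A (x^') --> l.

(* D i is the i-th derivative. *)
Definition Ck_derivatives (R : realType) (k : nat) (A : set R)
    (D : nat -> R -> R) : Prop :=
  (forall i, (i < k)%N -> forall x, A x ->
     is_derive_within A (D i) x (D i.+1 x)) /\
  (forall i, (i <= k)%N -> {within A, continuous (D i)}).

Definition Ck (R : realType) (k : nat) (A : set R) (f : R -> R) : Prop :=
  exists D, D 0%N = f /\ Ck_derivatives k A D.

Definition Ckb (R : realType) (k : nat) (A : set R) (f : R -> R) : Prop :=
  exists D, [/\ D 0%N = f, Ck_derivatives k A D &
    forall i, (i <= k)%N -> exists M, forall x, A x -> `|D i x| <= M].

Section Sobolev.
Variable R : realType.
Let mu := @lebesgue_measure R.

Definition L2plus (f : R -> R) : Prop := (f \_ (Rplus R)) \in Lfun mu 2%:E.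

Definition L2norm (f : R -> R) : R :=
  fine ('N[mu]_2%:E[EFin \o (f \_ (Rplus R))])%E.

(* C_c^oo(]0, +oo[) *)
Definition test_function (phi : R -> R) : Prop :=
  (forall n x, derivable (derive1n n phi) x 1) /\
  exists a b, 0 < a /\ forall x, phi x != 0 -> a <= x <= b.

(* g is the k-th derivative of f in the sense of distributions on ]0, +oo[. *)
Definition is_weak_derivative (k : nat) (f g : R -> R) : Prop :=
  forall phi, test_function phi ->
    \int[mu]_(x in Rplus R) (f x * derive1n k phi x) =
    (-1) ^+ k * \int[mu]_(x in Rplus R) (g x * phi x).

(* f is in H^2(R^+), with weak derivatives f1 and f2. *)
Definition H2_with (f f1 f2 : R -> R) : Prop :=
  [/\ L2plus f, L2plus f1, L2plus f2,
      is_weak_derivative 1 f f1 & is_weak_derivative 2 f f2].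

Definition H2 (f : R -> R) : Prop := exists f1 f2, H2_with f f1 f2.

(* The H^2 norm of f when H2_with f f1 f2. *)
Definition H2norm (f f1 f2 : R -> R) : R :=
  Num.sqrt (L2norm f ^+ 2 + L2norm f1 ^+ 2 + L2norm f2 ^+ 2).

(* t |-> u(., t) belongs to C(I; H^2(R^+)). The choice of the representatives
   u1, u2 of the weak derivatives is immaterial: they are unique a.e. *)
Definition C_H2 (I : set R) (u : R -> R -> R) : Prop :=
  exists u1 u2 : R -> R -> R,
    (forall t, I t -> H2_with (u^~ t) (u1^~ t) (u2^~ t)) /\
    (forall s, I s ->
       (fun t => H2norm (fun x => u x t - u x s) (fun x => u1 x t - u1 x s)
                        (fun x => u2 x t - u2 x s))
         @ within I (nbhs s) --> (0 : R)).

(* partial i j phi = d^i/dx^i d^j/dt^j phi *)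
Definition partial (i j : nat) (phi : R -> R -> R) (x t : R) : R :=
  derive1n i (fun y => derive1n j (phi y) t) x.

(* C_c^oo(]0, +oo[ x ]0, T[) *)
Definition test_function2 (T : \bar R) (phi : R -> R -> R) : Prop :=
  [/\ forall j x t, derivable (derive1n j (phi x)) t 1,
      forall i j x t, derivable (partial i j phi ^~ t) x 1,
      forall i j, continuous (fun p : R * R => partial i j phi p.1 p.2) &
      exists a b c d, [/\ 0 < a, 0 < c, (d%:E < T)%E &
        forall x t, phi x t != 0 -> a <= x <= b /\ c <= t <= d]].

(* u_t - gamma u_xxt = 0 with pointwise partial derivatives on R^+ x I. *)
Definition classical_equation (gamma : R) (T : \bar R) (u : R -> R -> R) :
    Prop :=
  let I := time_interval T in
  exists ux uxx ut uxxt : R -> R -> R, forall x t, Rplus R x -> I t ->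
    [/\ is_derive_within (Rplus R) (u^~ t) x (ux x t),
        is_derive_within (Rplus R) (ux^~ t) x (uxx x t),
        is_derive_within I (u x) t (ut x t),
        is_derive_within I (uxx x) t (uxxt x t) &
        ut x t - gamma * uxxt x t = 0].

(* u_t - gamma u_xxt = 0 in the sense of distributions on ]0, +oo[ x ]0, T[;
   an odd number of derivatives falls on phi in both terms. *)
Definition distributional_equation (gamma : R) (T : \bar R)
    (u : R -> R -> R) : Prop :=
  forall phi, test_function2 T phi ->
    \int[mu]_(t in time_interval T) (\int[mu]_(x in Rplus R)
      (u x t * (- (partial 0 1 phi x t - gamma * partial 2 1 phi x t)))) = 0.

(* u solves the initial- and boundary-value problem in the class C(I; H^2),
   the differential equation being understood through equation. Each u(., t)
   is the continuous representative of its H^2 class, so that the initial and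
   boundary values are meaningful pointwise. *)
Definition ibvp_solution (equation : (R -> R -> R) -> Prop) (T : \bar R)
    (u0 g : R -> R) (u : R -> R -> R) : Prop :=
  let I := time_interval T in
  [/\ C_H2 I u,
      forall t, I t -> {within Rplus R, continuous (u^~ t)},
      equation u,
      forall x, Rplus R x -> u x 0 = u0 x &
      forall t, I t -> u 0 t = g t].

Definition is_the_ibvp_solution (equation : (R -> R -> R) -> Prop)
    (T : \bar R) (u0 g : R -> R) (u : R -> R -> R) : Prop :=
  ibvp_solution equation T u0 g u /\
  forall v, ibvp_solution equation T u0 g v ->
    forall x t, Rplus R x -> time_interval T t -> v x t = u x t.

End Sobolev.

(* Main.v *)
Require Import Defs.
From HB Require Import structures.
From mathcomp Require Import all_boot all_order all_algebra.
From mathcomp Require Import all_classical all_reals all_analysis.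
From mathcomp Require Import measurable_realfun lebesgue_integral_under.
From mathcomp Require Import ring lra.

Set Implicit Arguments.
Unset Strict Implicit.
Unset Printing Implicit Defensive.

Import Order.TTheory GRing.Theory Num.Theory.
Import numFieldNormedType.Exports.

Local Open Scope classical_set_scope.
Local Open Scope ring_scope.

(* Let k = 1 / sqrt gamma. For both notions of solution v - gamma v_xx does not
   depend on t, so the difference w of two solutions with the same data satisfies
   w = gamma w_xx and w(0) = 0. Hence w is a multiple of sinh (k x), and it
   vanishes because it is square integrable. For distributional solutions this is
   done without derivatives of w: testing with chi(x) eta(t) shows that the
   pairing of v(., t) with chi - gamma chi'' is constant in t, and chi can be
   chosen so that chi - gamma chi'' is a combination, with weights c_i, of bumps
   concentrating at points a_i, as soon as sum_i c_i exp(k a_i) =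
   sum_i c_i exp(- k a_i) = 0. So sum_i c_i w(a_i) = 0 for such weights; with
   three points this determines w up to a multiple of sinh (k x).
   That u is a distributional solution reduces, through the weak derivatives of u0
   and of exp(- k x), to the vanishing of the integral of
   (gamma u0'' - u0)(x) phi_t(x, t), which is a time derivative. *)

(** * Smooth functions and smooth steps *)

(** The definition of a distributional solution provides no pointwise derivatives in [x], and the
    equation tests it only inside the open domain, away from x = 0, t = 0 and t = T; hence the
    detour through averages. Since exp (k x) and exp (- k x) are annihilated by 1 - gamma d^2/dx^2,
    every chi - gamma chi'' with chi of compact support is orthogonal to both: this is where the two
    conditions on the weights come from, and they are also sufficient. Three bumps are the fewest
    for which two linear conditions always leave nonzero weights. Using translates of one profile
    makes these conditions exact at every width, so the limit of small width can be taken with fixed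
    weights. Values at the edge of the domain are recovered by continuity: in t through C(I; H^2),
    in x through the continuous representative. A single smooth step serves both variables: its
    derivative gives the bumps, and a difference of two steps is a compactly supported function of t
    whose derivative is a difference of two bumps. *)

Section Smooth.
Variable R : realType.
Implicit Types f g h : R -> R.

Record smooth f : Prop := Smooth {
  derivable_smooth : forall n (x : R), derivable (derive1n n f) x 1 }.
Arguments derivable_smooth {f} _ n x.

Lemma smooth_derive1 f : smooth f -> smooth (derive1 f).
Proof.
by move=> sf; constructor=> n x; have := derivable_smooth sf n.+1 x; rewrite /derive1n iterSr.
Qed.

Lemma smooth_derive1n n f : smooth f -> smooth (derive1n n f).
Proof.
by move=> sf; elim: n => [//|n IH]; rewrite derive1nS; exact: smooth_derive1.
Qed.

Lemma smooth_is_derive f (x : R) : smooth f -> is_derive x 1 f ((derive1 f) x).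
Proof. by move=> sf; rewrite derive1E; apply/derivableP; exact: (derivable_smooth sf 0%N). Qed.

Lemma smooth_continuous f : smooth f -> continuous f.
Proof.
by move=> sf x; apply/differentiable_continuous; rewrite -derivable1_diffP; exact: (derivable_smooth sf 0%N).
Qed.

Lemma is_derive_funext f df : (forall x : R, is_derive x 1 f (df x)) -> (derive1 f) = df.
Proof. by move=> d; apply/funext => x; rewrite derive1E; case: (d x). Qed.

(** Smoothness is the largest class closed under differentiation, so exhibiting one such class that
    contains [f] is enough and no formula for the n-th derivative is needed. *)
Lemma smooth_coind (S : (R -> R) -> Prop) :
  (forall f, S f -> exists2 df, S df & forall x : R, is_derive x 1 f (df x)) ->
  forall f, S f -> smooth f.
Proof.
move=> HS f Sf; constructor=> n x.
have [g Sg ->] : exists2 g, S g & derive1n n f = g.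
  elim: n => [|n [g Sg eg]]; first by exists f.
  have [dg Sdg Dg] := HS _ Sg.
  by exists dg => //; rewrite derive1nS eg; exact: is_derive_funext.
by have [dg _ /(_ x) []] := HS _ Sg.
Qed.

(* Derivatives of products are sums of products, so smoothness of products is
   proved for the whole algebra generated by smooth functions. *)
Inductive smooth_alg : (R -> R) -> Prop :=
| SmoothBase f of smooth f : smooth_alg f
| SmoothAdd f g of smooth_alg f & smooth_alg g : smooth_alg (fun x => f x + g x)
| SmoothMul f g of smooth_alg f & smooth_alg g : smooth_alg (fun x => f x * g x).

Lemma smooth_alg_smooth f : smooth_alg f -> smooth f.
Proof.
move: f; apply: smooth_coind => f; elim=> {}f.
- move=> sf; exists (derive1 f); first exact/SmoothBase/smooth_derive1.
  by move=> x; exact: smooth_is_derive.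
- move=> g sf [df Sdf Df] sg [dg Sdg Dg].
  by exists (fun x => df x + dg x); [exact: SmoothAdd|move=> x; exact: is_deriveD].
- move=> g sf [df Sdf Df] sg [dg Sdg Dg].
  exists (fun x => f x * dg x + df x * g x).
    by apply: SmoothAdd; exact: SmoothMul.
  move=> x; apply: is_derive_eq; rewrite /GRing.scale/=; ring.
Qed.

Lemma smoothD f g : smooth f -> smooth g -> smooth (fun x => f x + g x).
Proof. by move=> sf sg; apply/smooth_alg_smooth/SmoothAdd; exact: SmoothBase. Qed.

Lemma smoothM f g : smooth f -> smooth g -> smooth (fun x => f x * g x).
Proof. by move=> sf sg; apply/smooth_alg_smooth/SmoothMul; exact: SmoothBase. Qed.

Lemma smooth_cst (c : R) : smooth (fun=> c).
Proof.
apply: (@smooth_coind (fun f => exists c, f = fun=> c)); last by exists c.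
by move=> f [a ->]; exists (fun=> 0); [exists 0|move=> x; exact: is_derive_cst].
Qed.

Lemma smoothZ (c : R) f : smooth f -> smooth (fun x => c * f x).
Proof. by move=> sf; apply: smoothM => //; exact: smooth_cst. Qed.

Lemma smoothB f g : smooth f -> smooth g -> smooth (fun x => f x - g x).
Proof.
move=> sf sg; rewrite (_ : (fun x => _) = (fun x => f x + (-1) * g x)).
  by apply: smoothD => //; exact: smoothZ.
by apply/funext => x; rewrite mulN1r.
Qed.

Lemma is_derive_affine (r s x : R) f (df : R) : is_derive (r * x + s) 1 f df ->
  is_derive x 1 (fun y => f (r * y + s)) (r * df).
Proof.
move=> D.
have D2 : is_derive x 1 (fun y : R => r * y + s) r.
  by apply: is_derive_eq; rewrite /GRing.scale/=; ring.
have := @is_derive1_comp _ f (fun y : R => r * y + s) x df r D D2.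
by rewrite mulrC.
Qed.

Lemma smooth_affine (r s : R) f : smooth f -> smooth (fun x => f (r * x + s)).
Proof.
(* The factor [c] absorbs the powers of [r] produced by the chain rule. *)
move=> sf; apply: (@smooth_coind (fun h => exists c g,
  smooth g /\ h = fun x => c * g (r * x + s))).
  move=> h [c [g [sg ->]]]; exists (fun x => (c * r) * (derive1 g) (r * x + s)).
    by exists (c * r), (derive1 g); split => //; exact: smooth_derive1.
  move=> x.
  have D : is_derive x 1 (fun y => g (r * y + s)) (r * (derive1 g) (r * x + s)).
    by apply: is_derive_affine; exact: smooth_is_derive.
  by apply: is_derive_eq; rewrite /GRing.scale/=; ring.
by exists 1, f; split => //; apply/funext => x; rewrite mul1r.
Qed.

Lemma smooth_primitive F f : smooth f -> (forall x : R, is_derive x 1 F (f x)) -> smooth F.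
Proof.
move=> sf D; apply: (@smooth_coind (fun h => h = F \/ smooth h)); last by left.
move=> h [->|sh]; first by exists f => //; right.
by exists (derive1 h); [right; exact: smooth_derive1|move=> x; exact: smooth_is_derive].
Qed.

Lemma is_derive_expM (k x : R) :
  is_derive x 1 (fun y => expR (k * y)) (k * expR (k * x)).
Proof.
rewrite (_ : (fun y => _) = (fun y => expR (k * y + 0))); last first.
  by apply/funext => y; rewrite addr0.
apply: (is_derive_eq (is_derive_affine (is_derive_expR _))); by rewrite addr0.
Qed.

Lemma smooth_expM (k : R) : smooth (fun x => expR (k * x)).
Proof.
apply: (@smooth_coind (fun h => exists c, h = fun x => c * expR (k * x))).
  move=> h [c ->]; exists (fun x => c * k * expR (k * x)); first by exists (c * k).
  move=> x; have := is_derive_expM k x => D.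
  by apply: is_derive_eq; rewrite /GRing.scale/=; ring.
by exists 1; apply/funext => x; rewrite mul1r.
Qed.

Lemma derive1nD n f g : smooth f -> smooth g ->
  derive1n n (fun x => f x + g x) = (fun x => derive1n n f x + derive1n n g x).
Proof.
move=> sf sg; elim: n => [//|n IH]; rewrite !derive1nS IH.
apply: is_derive_funext => x; apply: is_deriveD.
  by apply: smooth_is_derive; exact: smooth_derive1n.
by apply: smooth_is_derive; exact: smooth_derive1n.
Qed.

Lemma derive1nZ n (c : R) f : smooth f ->
  derive1n n (fun x => c * f x) = (fun x => c * derive1n n f x).
Proof.
move=> sf; elim: n => [//|n IH]; rewrite !derive1nS IH.
apply: is_derive_funext => x.
have D : is_derive x 1 (derive1n n f) ((derive1 (derive1n n f)) x).
  by apply: smooth_is_derive; exact: smooth_derive1n.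
by apply: is_derive_eq; rewrite /GRing.scale/=; ring.
Qed.

(** The complement of a closed interval is open, so a function that vanishes there has zero
    derivative there as well. *)
Lemma derive1n_outside n f (a b : R) : (forall x, f x != 0 -> a <= x <= b) ->
  forall x, derive1n n f x != 0 -> a <= x <= b.
Proof.
move=> fab; elim: n => [//|n IH] x; rewrite derive1nS.
apply: contraNT => /negP xab; rewrite derive1E.
suff : is_derive x 1 (derive1n n f) 0 by case=> _ ->.
have near0 : \forall y \near x, derive1n n f y = 0.
  have [xa|ax] := ltP x a.
    near=> y; apply/eqP; apply: contraT => /IH /andP[+ _].
    by rewrite leNgt => /negP; case; near: y; exact: lt_nbhsl.
  have bx : b < x by rewrite ltNge; apply/negP => xb; apply: xab; rewrite ax.
  near=> y; apply/eqP; apply: contraT => /IH /andP[_].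
  by rewrite leNgt => /negP; case; near: y; exact: lt_nbhsr.
apply: (@near_eq_is_derive _ _ _ (fun=> 0) _ x 1 0).

  by apply: filterS near0 => y ->.
Unshelve. all: by end_near. Qed.

End Smooth.

(** * Flat functions and the construction of a smooth step *)

Section FlatFunction.
Variable R : realType.
Implicit Types p : {poly R}.

(** Letting [p] range over all polynomials makes the family closed under differentiation, as
    [smooth_coind] demands; [p = 1] is the classical flat function. *)
Definition flat p (x : R) : R := if 0 < x then p.[x^-1] * expR (- x^-1) else 0.

Lemma flat_le p : exists2 C, 0 <= C & forall x, 0 < x -> `|flat p x| <= C * x.
Proof.
exists (\sum_(i < size p) `|p`_i| * (i.+1)`!%:R).
  by apply: sumr_ge0 => i _; rewrite mulr_ge0.
move=> x x0; rewrite /flat x0 horner_coef normrM (ger0_norm (expR_ge0 _)).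
rewrite (le_trans (ler_wpM2r (expR_ge0 _) (ler_norm_sum _ _ _)))//.
rewrite !mulr_suml ler_sum// => i _; rewrite normrM -!mulrA ler_wpM2l//.
have y0 : 0 < x^-1 by rewrite invr_gt0.
rewrite normrX (gtr0_norm y0) expRN ler_pdivrMr ?expR_gt0//.
(* The exponential series is used at order [i.+1], one more than the monomial: the spare power of
   [x^-1] becomes the factor [x] of the bound. *)
have := expR_ge1Dxn i (ltW y0) => H.
have f0 : 0 < (i.+1)`!%:R :> R by rewrite ltr0n fact_gt0.
have {}H : x^-1 ^+ i.+1 <= (i.+1)`!%:R * expR (x^-1).
  by rewrite -ler_pdivrMl// mulrC (le_trans _ H)// lerDr.
have -> : x^-1 ^+ i = x * x^-1 ^+ i.+1 by rewrite exprS mulrA mulfV ?mul1r// gt_eqF.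
by rewrite mulrAC [leRHS]mulrC ler_pM2l.
Qed.

Lemma is_derive_flat p (x : R) :
  is_derive x 1 (flat p) (flat ('X^2 * (p - p^`())) x).
Proof.
have [x0|x0|->] := ltgtP x 0.
- rewrite [X in is_derive _ _ _ X]/flat ltNge (ltW x0)/=.
  apply: (@near_eq_is_derive _ _ _ (fun=> 0) _ x 1 0).
  by near=> y; rewrite /flat ltNge ltW//; near: y; exact: lt_nbhsl.
- have near_x : \forall y \near x, p.[y^-1] * expR (- y^-1) = flat p y.
    by near=> y; rewrite /flat ifT//; near: y; exact: lt_nbhsr.
  apply: (near_eq_is_derive near_x).
  have xn0 : x != 0 by rewrite gt_eqF.
  have Dinv : is_derive x 1 (fun y : R => y^-1) (- (x ^- 2)).
    apply: (is_derive_eq (is_deriveV (f := id) xn0 (is_derive_id _ _))).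
    by rewrite /GRing.scale/= mulr1.
  have Dp : is_derive x 1 (fun y : R => p.[y^-1]) (p^`().[x^-1] * - (x ^- 2)).
    exact: (@is_derive1_comp _ (horner p) (fun y : R => y^-1)).
  have De : is_derive x 1 (fun y : R => expR (- y^-1)) (expR (- x^-1) * (x ^- 2)).
    apply: (@is_derive1_comp _ expR (fun y : R => - y^-1)).
    by apply: is_derive_eq; rewrite opprK.
  apply: is_derive_eq; rewrite /flat x0 /GRing.scale/= !hornerE/=.
  by rewrite -exprVn; ring.
- rewrite [X in is_derive _ _ _ X]/flat ltxx.
  (* For h > 0 the difference quotient of [flat p] at 0 equals [flat ('X * p) h], so the linear
     bound makes it tend to 0. *)
  have [C C0 HC] := flat_le ('X * p).
  have L : (fun h : R => h^-1 *: ((flat p \o shift 0) (h *: 1) - flat p 0)) @ 0^' --> (0:R).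
    apply: norm_cvg0; apply: (@squeeze_cvgr _ _ _ _ (fun=> 0) (fun h : R => C * `|h|)).
    + near=> h; rewrite normr_ge0/= addr0 /GRing.scale/= mulr1.
      rewrite {2}/flat ltxx subr0.
      have [h0|h0] := ltP 0 h; last by rewrite {1}/flat ltNge h0/= mulr0 normr0 mulr_ge0.
      have := HC _ h0; rewrite /flat h0 !hornerE/= (gtr0_norm h0); exact.
    + exact: cvg_cst.
    + rewrite -[X in _ --> X](mulr0 C); apply: cvgM; first exact: cvg_cst.
      rewrite -[X in _ --> X](@normr0 _ R); apply: cvg_norm.
      exact: nbhs_dnbhs.
  by split; [apply/cvg_ex; exists 0|apply: cvg_lim].
Unshelve. all: by end_near. Qed.

Lemma smooth_flat p : smooth (flat p).
Proof.
apply: (@smooth_coind _ (fun f => exists q, f = flat q)); last by exists p.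
move=> f [q ->]; exists (flat ('X^2 * (q - q^`()))); first by eexists.
by move=> x; exact: is_derive_flat.
Qed.

Lemma primitive_halfline (f : R -> R) : continuous f -> (forall x, x <= 0 -> f x = 0) ->
  exists2 F : R -> R, (forall x : R, is_derive x 1 F (f x)) & forall x, x <= 0 -> F x = 0.
Proof.
move=> cf f0.
(* A negative base point places every x >= 0, including 0, in the interior of the interval on which
   the fundamental theorem is applied. *)
pose F x := \int[lebesgue_measure]_(t in `[-1, x]) f t.
have F0 x : x <= 0 -> F x = 0.
  move=> x0; rewrite /F /Rintegral (eq_integral (fun=> 0%E)) ?integral0//.
  by move=> y /set_mem /=; rewrite in_itv/= => /andP[_ yx]; rewrite f0// (le_trans yx).
exists F => // x; have [x0|x0] := ltP x 0.
  rewrite f0 ?ltW//; apply: (@near_eq_is_derive _ _ _ (fun=> 0) _ x 1 0).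
  by near=> y; rewrite F0// ltW//; near: y; exact: lt_nbhsl.
have [|||d e] := @continuous_FTC1_closed R f (-1) x (x + 1) _ _ _ (cf x).
- by rewrite ltrDl.
- apply: continuous_compact_integrable; first exact: segment_compact.
  exact: continuous_subspaceT.
- by rewrite (lt_le_trans _ x0)// ltrN10.
by apply: DeriveDef; [exact: d|rewrite -derive1E; exact: e].
Unshelve. all: by end_near. Qed.

Lemma is_derive_continuous (F f : R -> R) : (forall x : R, is_derive x 1 F (f x)) ->
  continuous F.
Proof.
by move=> D x; apply/differentiable_continuous/derivable1_diffP; case: (D x).
Qed.

Lemma is_derive0_eq (F f : R -> R) (a b : R) : (forall x : R, is_derive x 1 F (f x)) ->
  a <= b -> (forall x, a <= x <= b -> f x = 0) -> F b = F a.
Proof.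
move=> D ab f0; have [c cab] := @MVT_segment R F f a b ab (fun x _ => D x)
  (continuous_subspaceT (is_derive_continuous D)).
rewrite in_itv/= in cab; rewrite f0// mul0r => /eqP; rewrite subr_eq0 => /eqP //.
Qed.

Lemma smooth_step_exists : exists M : R -> R, [/\ smooth M, (forall x, 0 <= derive1 M x),
  (forall x, x <= 0 -> M x = 0) & (forall x, 1 <= x -> M x = 1)].
Proof.
(* Positive exactly on ]0, 1[. Its primitive divided by the total mass [F 1] is the step; the mass
   is positive by the mean value theorem. *)
pose f x := flat 1 x * flat 1 ((-1) * x + 1).
have flat_ge0 x : 0 <= flat 1 x.
  by rewrite /flat; case: ifP => // _; rewrite mulr_ge0 ?expR_ge0 ?hornerC.
have flat_gt0 x : 0 < x -> 0 < flat 1 x.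
  by move=> x0; rewrite /flat x0 mulr_gt0 ?expR_gt0 ?hornerC.
have flat0 x : x <= 0 -> flat 1 x = 0 by move=> x0; rewrite /flat ltNge x0.
have sf : smooth f by apply: smoothM; [|apply: smooth_affine]; exact: smooth_flat.
have f0 x : x <= 0 -> f x = 0 by move=> x0; rewrite /f flat0 ?mul0r.
have f1 x : 1 <= x -> f x = 0 by move=> x1; rewrite /f (flat0 (_ + _)) ?mulr0//; lra.
have [F DF F0] := primitive_halfline (smooth_continuous sf) f0.
have F1 x : 1 <= x -> F x = F 1.
  by move=> x1; apply: (is_derive0_eq DF) => // y /andP[y1 _]; exact: f1.
have F1gt0 : 0 < F 1.
  have [c] := @MVT R F f 0 1 ltr01 (fun x _ => DF x)
    (continuous_subspaceT (is_derive_continuous DF)).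
  rewrite in_itv/= => /andP[c0 c1]; rewrite (F0 0)// !subr0 mulr1 => ->.
  by rewrite mulr_gt0// flat_gt0//; lra.
have dM (x : R) : is_derive x 1 (fun x => (F 1)^-1 * F x) ((F 1)^-1 * f x).
  by have := DF x => D; apply: is_derive_eq; rewrite /GRing.scale/=; ring.
exists (fun x => (F 1)^-1 * F x); split.
- by apply: smoothZ; apply: smooth_primitive DF.
- move=> x; rewrite (is_derive_funext dM); apply: mulr_ge0.
    by rewrite invr_ge0 ltW.
  by apply: mulr_ge0; exact: flat_ge0.
- by move=> x x0; rewrite (F0 x)// mulr0.
- by move=> x x1; rewrite (F1 x)// mulVf// gt_eqF.
Qed.

End FlatFunction.

(** * Integrals against bumps *)

Section Integrals.
Variable R : realType.
Let mu := @lebesgue_measure R.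
Implicit Types (A B J : set R) (f g q psi : R -> R).

Lemma patch_sub A B f : A `<=` B -> (forall x, B x -> f x != 0 -> A x) ->
  f \_ B = f \_ A.
Proof.
move=> AB fA; apply/funext => x; rewrite !patchE.
have [xA|xA] := boolP (x \in A).
  by rewrite mem_set//; exact/AB/set_mem.
case: ifPn => // /set_mem Bx; apply/eqP; apply: contraNT xA => fx.
by apply/mem_set; exact: fA.
Qed.

Lemma Rintegral_sub A B f : A `<=` B -> (forall x, B x -> f x != 0 -> A x) ->
  \int[mu]_(x in B) f x = \int[mu]_(x in A) f x.
Proof. by move=> AB fA; rewrite Rintegral_mkcond (patch_sub AB fA) -Rintegral_mkcond. Qed.

Lemma integrable_patch A f : measurable A ->
  mu.-integrable A (EFin \o f) <-> mu.-integrable setT (EFin \o f \_ A).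
Proof. by move=> mA; rewrite -restrict_EFin; exact: integrable_mkcond. Qed.

Lemma integrable_sub A B f : measurable A -> measurable B ->
  A `<=` B -> (forall x, B x -> f x != 0 -> A x) ->
  mu.-integrable A (EFin \o f) -> mu.-integrable B (EFin \o f).
Proof. move=> mA mB AB fA /(integrable_patch _ mA) fi.
by apply/(integrable_patch _ mB); rewrite (patch_sub AB fA). Qed.

Lemma integrableD_EFin A f g : measurable A -> mu.-integrable A (EFin \o f) ->
  mu.-integrable A (EFin \o g) -> mu.-integrable A (EFin \o (fun x => f x + g x)).
Proof.
move=> mA fi gi; rewrite /comp; under eq_fun do rewrite EFinD.
exact: integrableD.
Qed.

Lemma integrableB_EFin A f g : measurable A -> mu.-integrable A (EFin \o f) ->
  mu.-integrable A (EFin \o g) -> mu.-integrable A (EFin \o (fun x => f x - g x)).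
Proof.
move=> mA fi gi; rewrite /comp; under eq_fun do rewrite EFinB.
exact: integrableB.
Qed.

Lemma integrableZl_EFin A f (c : R) : measurable A -> mu.-integrable A (EFin \o f) ->
  mu.-integrable A (EFin \o (fun x => c * f x)).
Proof.
move=> mA fi; rewrite /comp; under eq_fun do rewrite EFinM.
exact: integrableZl.
Qed.

Lemma measurable_Rplus : measurable (Rplus R : set (measurableTypeR R)).
Proof.
rewrite (_ : Rplus R = `[0, +oo[%classic); first exact: measurable_itv.
by apply/seteqP; split => x; rewrite /Rplus/= in_itv/= andbT.
Qed.

Lemma measurable_time_interval (T : \bar R) :
  measurable (time_interval T : set (measurableTypeR R)).
Proof.
case: T => [T| |].
- rewrite (_ : time_interval _ = `[0, T]%classic); first exact: measurable_itv.
  by apply/seteqP; split => x; rewrite /time_interval/= in_itv/= lee_fin => /andP.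
- rewrite (_ : time_interval _ = `[0, +oo[%classic); first exact: measurable_itv.
  apply/seteqP; split => x; rewrite /time_interval/= in_itv/= andbT ?leey//.
  by case.
- rewrite (_ : time_interval _ = set0) //.
  by apply/seteqP; split => x //= []; rewrite leeNy_eq.
Qed.

Lemma test_mul_integrable J q psi (a b : R) : measurable J -> {within J, continuous q} ->
  continuous psi -> `[a, b] `<=` J -> (forall x, psi x != 0 -> a <= x <= b) ->
  mu.-integrable J (EFin \o (fun x => q x * psi x)).
Proof.
move=> mJ cq cp abJ pab; apply: (@integrable_sub `[a, b]) => //.
- by move=> x _; rewrite mulf_eq0 negb_or /= in_itv/= => /andP[_ /pab].
- apply: continuous_compact_integrable; first exact: segment_compact.
  have cq' : {within `[a, b], continuous q} by exact: continuous_subspaceW cq.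
  have cp' : {within `[a, b], continuous psi} by exact: continuous_subspaceT.
  by move=> x; apply: continuousM; [exact: cq'|exact: cp'].
Qed.

Variables (M : R -> R) (smooth_M : smooth M) (M_ge0 : forall x, 0 <= derive1 M x).
Hypothesis M0 : forall x, x <= 0 -> M x = 0.
Hypothesis M1 : forall x, 1 <= x -> M x = 1.

(** The rise from 0 to 1 takes place on an interval of length 1/(n + 1) to the right of [a], so the
    derivative [bump] is a smooth approximation of the Dirac mass at [a]. *)
Definition step (n : nat) (a x : R) : R := M (n.+1%:R * x + - (n.+1%:R * a)).
Definition bump (n : nat) (a : R) : R -> R := derive1 (step n a).

Lemma smooth_step n a : smooth (step n a).
Proof. exact: smooth_affine. Qed.

Lemma smooth_bump n a : smooth (bump n a).
Proof. exact/smooth_derive1/smooth_step. Qed.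

Lemma is_derive_step n a (x : R) : is_derive x 1 (step n a) (bump n a x).
Proof. exact/smooth_is_derive/smooth_step. Qed.

Lemma bump_ge0 n a x : 0 <= bump n a x.
Proof.
have D (y : R) : is_derive y 1 (step n a)
    (n.+1%:R * derive1 M (n.+1%:R * y + - (n.+1%:R * a))).
  by apply: is_derive_affine; exact: smooth_is_derive.
by rewrite /bump (is_derive_funext D) mulr_ge0.
Qed.

Lemma step_le n a x : x <= a -> step n a x = 0.
Proof. by move=> xa; rewrite /step M0// subr_le0 ler_pM2l. Qed.

Lemma step_ge n a x : a + n.+1%:R^-1 <= x -> step n a x = 1.
Proof.
move=> xa; rewrite /step M1// -mulrBr -(@ler_pM2l _ n.+1%:R^-1)//.
by rewrite mulr1 mulKf// lerBrDl.
Qed.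

Lemma bump_support n a x : bump n a x != 0 -> a <= x <= a + n.+1%:R^-1.
Proof.
apply: contraNT => /negP H; apply/eqP.
suff D : is_derive x 1 (step n a) 0 by rewrite /bump derive1E; case: D.
have [xa|ax] := ltP x a.
  apply: (@near_eq_is_derive _ _ _ (fun=> 0) _ x 1 0).
  by near=> y; rewrite step_le// ltW//; near: y; exact: lt_nbhsl.
have {H}ax1 : a + n.+1%:R^-1 < x.
  by rewrite ltNge; apply/negP => xa; apply: H; rewrite ax.
apply: (@near_eq_is_derive _ _ _ (fun=> 1 : R) _ x 1 0).
by near=> y; rewrite step_ge// ltW//; near: y; exact: lt_nbhsr.
Unshelve. all: by end_near. Qed.

Lemma smooth_FTC2 F f (a b : R) : a < b -> (forall x : R, is_derive x 1 F (f x)) ->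
  continuous f -> \int[mu]_(x in `[a, b]) f x = F b - F a.
Proof.
move=> ab D cf; rewrite /Rintegral (@continuous_FTC2 _ f F a b)//.
- exact: continuous_subspaceT.
- have cF := is_derive_continuous D; split.
  + by move=> x _; case: (D x).
  + by apply: cvg_at_right_filter; exact: cF.
  + by apply: cvg_at_left_filter; exact: cF.
- by move=> x _; rewrite (is_derive_funext D).
Qed.

Lemma Rintegral_bump n a :
  \int[mu]_(x in `[a, a + n.+1%:R^-1]) bump n a x = 1.
Proof.
rewrite (smooth_FTC2 _ (is_derive_step n a)).
- by rewrite step_ge// step_le// subr0.
- by rewrite ltrDl.
- exact/smooth_continuous/smooth_bump.
Qed.

(** A bump is nonnegative of mass 1, so the error is at most the oscillation of [q] just to the
    right of [a]; hence [a] may be the left end point of [J]. *)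
Lemma cvg_bump J q (a d : R) : measurable J -> {within J, continuous q} -> 0 < d ->
  `[a, a + d] `<=` J ->
  (fun n => \int[mu]_(x in J) (q x * bump n a x)) @ \oo --> q a.
Proof.
move=> mJ /[dup] cq /subspace_continuousP cqa d0 adJ.
have Ja : J a by apply: adJ; rewrite /= in_itv/= lexx lerDl ltW.
apply/cvgrPdist_le => e e0.
have := cqa _ Ja => /cvgrPdist_le /(_ e e0).
rewrite near_withinE => /nbhs_ballP[r /= r0 Hr].
near=> n.
have nr : n.+1%:R^-1 < r :> R.
  by near: n; exact: near_infty_natSinv_lt (PosNum r0).
have nd : n.+1%:R^-1 < d :> R.
  by near: n; exact: near_infty_natSinv_lt (PosNum d0).
set h := n.+1%:R^-1 in nr nd.
have supp x : bump n a x != 0 -> a <= x <= a + h by exact: bump_support.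
have h0 : 0 < h by rewrite /h.
have bump1 : \int[mu]_(x in `[a, a + h]) bump n a x = 1 by exact: Rintegral_bump.
move: h supp nr nd h0 bump1 => h supp nr nd h0 bump1.
have ahJ : `[a, a + h] `<=` J.
  move=> x /= ; rewrite in_itv/= => /andP[ax xh]; apply: adJ; rewrite /= in_itv/= ax/=; lra.
rewrite (@Rintegral_sub `[a, a + h])//; last first.
  by move=> x _; rewrite mulf_eq0 negb_or /= in_itv/= => /andP[_ /supp].
have cb : continuous (bump n a) by exact/smooth_continuous/smooth_bump.
have cqh : {within `[a, a + h], continuous q} by exact: continuous_subspaceW cq.
have I1 : mu.-integrable `[a, a + h] (EFin \o (fun x => q x * bump n a x)).
  by apply: (@test_mul_integrable _ _ _ a (a + h)) => //; exact: supp.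
have I2 : mu.-integrable `[a, a + h] (EFin \o (fun x => q a * bump n a x)).
  apply: (@test_mul_integrable _ (fun=> q a) _ a (a + h)) => //.
  by apply: continuous_subspaceT => x; exact: cvg_cst.
have I0 : mu.-integrable `[a, a + h] (EFin \o bump n a).
  apply: continuous_compact_integrable; first exact: segment_compact.
  exact: continuous_subspaceT.
rewrite -[X in X - _]mulr1 -bump1 -RintegralZl//.
rewrite -RintegralB//.
have I12 : mu.-integrable `[a, a + h] (EFin \o (fun x => q a * bump n a x - q x * bump n a x)).
  exact: integrableB_EFin.
rewrite (le_trans (le_normr_Rintegral _ _))//.
rewrite -[leRHS]mulr1 -bump1 -RintegralZl//.
apply: le_Rintegral; first exact: measurable_itv.
- exact: integrable_norm.
- exact: integrableZl_EFin.
move=> x /= xah; rewrite -mulrBl normrM (ger0_norm (bump_ge0 _ _ _)).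
rewrite ler_wpM2r ?bump_ge0//; apply: Hr; last exact: ahJ.
move: xah; rewrite in_itv/= => /andP[ax xh]; rewrite /ball/= ler0_norm; lra.
Unshelve. all: by end_near. Qed.

End Integrals.

(** * Square integrable functions on the half-line *)

Section SquareIntegrable.
Variable R : realType.
Let mu := @lebesgue_measure R.
Implicit Types (f g psi : R -> R).
Let Rp := Rplus R.

Lemma mulr_patch f g (A : set R) :
  (fun x => f x * g x) \_ A = ((f \_ A) \* (g \_ A))%R.
Proof.
by apply/funext => x /=; rewrite !patchE; case: ifPn; rewrite ?mulr0.
Qed.

Lemma L2plus_of_sqr f : measurable_fun Rp f ->
  mu.-integrable Rp (EFin \o (fun x => f x ^+ 2)) -> L2plus f.
Proof.
move=> mf /(integrable_patch _ (@measurable_Rplus R)) fi.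
rewrite /L2plus inE; apply/andP; split; rewrite inE/=.
  exact/(measurable_restrictT _ (@measurable_Rplus R)).
rewrite /finite_norm unlock /Lnorm poweR_lty//.
move/integrableP : fi => [_]; apply: le_lt_trans.
rewrite le_eqVlt; apply/orP; left; apply/eqP; apply: eq_integral => x _ /=.
rewrite powR_mulrn// !patchE; case: ifPn => _; last first.
  (* Outside the set a restriction takes the default value [point], which is 0 in [R]. *)
  by rewrite -[point]/(0 : R) normr0 expr0n.
by rewrite normrX.
Qed.

Lemma L2plus_sqr f : L2plus f -> mu.-integrable Rp (EFin \o (fun x => f x ^+ 2)).
Proof.
move=> /Lfun2_integrable_sqr fi.
apply/(integrable_patch _ (@measurable_Rplus R)).
rewrite (_ : (fun x => f x ^+ 2) \_ Rp = fun x => (f \_ Rp) x ^+ 2)//.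
by apply/funext => x; rewrite !patchE; case: ifPn; rewrite // expr0n.
Qed.

Lemma L2plus_lin f g (c : R) : L2plus f -> L2plus g ->
  L2plus (fun x => f x + c * g x).
Proof.
move=> Lf Lg; rewrite /L2plus.
have [_ H] := @Lfun_submod_closed _ _ R mu 2%:E (lee1n 2).
rewrite (_ : _ \_ _ = c *: (g \_ Rp) + f \_ Rp); first exact: H.
apply/funext => x.
rewrite /= !fctE !patchE; case: ifPn => _; first by rewrite addrC.
by rewrite -[point]/(0 : R) scaler0 addr0.
Qed.

Lemma L2plus_integrableM f g : L2plus f -> L2plus g ->
  mu.-integrable Rp (EFin \o (fun x => f x * g x)).
Proof.
move=> Lf Lg; apply/(integrable_patch _ (@measurable_Rplus R)).
by rewrite mulr_patch; apply/Lfun1_integrable; exact: Lfun2_mul_Lfun1.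
Qed.

Lemma L2norm_ge0 f : 0 <= L2norm f.
Proof. by rewrite /L2norm fine_ge0// Lnorm_ge0. Qed.

Lemma L2norm_CauchySchwarz f g : L2plus f -> L2plus g ->
  `|\int[mu]_(x in Rp) (f x * g x)| <= L2norm f * L2norm g.
Proof.
move=> Lf Lg; have Ifg := L2plus_integrableM Lf Lg.
have mR := @measurable_Rplus R.
rewrite (le_trans (le_normr_Rintegral mR Ifg))//.
have fin h : L2plus h -> ('N[mu]_2%:E[EFin \o (h \_ Rp)] \is a fin_num)%E.
  move=> /andP[_]; rewrite inE/= /finite_norm => hlt.
  by rewrite ge0_fin_numE// Lnorm_ge0.
have mfun_ h : L2plus h -> measurable_fun setT (h \_ Rp).
  by move=> /andP[]; rewrite inE.
rewrite /L2norm -fineM ?fin// /Rintegral fine_le//.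
- have /integrableP[_ ] := Ifg.
  by move=> H; rewrite ge0_fin_numE ?integral_ge0// => x _; rewrite lee_fin.
- by rewrite fin_numM ?fin.
have -> : (\int[mu]_(x in Rp) (`|f x * g x|)%:E =
          'N[mu]_1[EFin \o ((f \_ Rp) \* (g \_ Rp))%R])%E.
  rewrite -mulr_patch Lnorm1 [LHS]integral_mkcond; apply: eq_integral => x _.
  by rewrite !patchE/= patchE; case: ifPn => // _; rewrite normr0.
apply: (@hoelder _ _ _ mu _ _ 2 2); [exact: mfun_|exact: mfun_|by []|by []|lra].
Qed.

Lemma L2norm_le_H2norm f f1 f2 : L2norm f <= H2norm f f1 f2.
Proof.
rewrite /H2norm -[leLHS](ger0_norm (L2norm_ge0 f)) -sqrtr_sqr ler_sqrt.
  by rewrite -addrA lerDl addr_ge0// sqr_ge0.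
by rewrite !addr_ge0// sqr_ge0.
Qed.

Lemma L2plus_test psi (a b : R) : continuous psi -> 0 <= a ->
  (forall x, psi x != 0 -> a <= x <= b) -> L2plus psi.
Proof.
move=> cp a0 pab; apply: L2plus_of_sqr.
  apply: subspace_continuous_measurable_fun; first exact: measurable_Rplus.
  exact: continuous_subspaceT.
rewrite (_ : (fun x => _) = fun x => psi x * psi x); last first.
  by apply/funext => x; rewrite expr2.
apply: (@test_mul_integrable _ _ psi psi a b) => //.
- exact: measurable_Rplus.
- exact: continuous_subspaceT.
- by move=> x /=; rewrite in_itv/= => /andP[ax _]; exact: le_trans ax.
Qed.

Lemma L2plus_exp (k : R) : 0 < k -> L2plus (fun x => expR (- k * x)).
Proof.
move=> k0; apply: L2plus_of_sqr.
  apply: subspace_continuous_measurable_fun; first exact: measurable_Rplus.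
  apply: continuous_subspaceT; exact: (smooth_continuous (@smooth_expM R (- k))).
have k20 : 0 < 2 * k by rewrite mulr_gt0.
(* The square exp (- 2 k x) is (2 k)^-1 times the density of the exponential law of rate 2 k. *)
have := integrable_exponential_pdf k20 => I1.
apply/(integrable_patch _ (@measurable_Rplus R)).
have := integrableZl_EFin (2 * k)^-1 (@measurableT _ _) I1.
congr (mu.-integrable _ (EFin \o _)); apply/funext => x.
rewrite /exponential_pdf !patchE.
rewrite (_ : `[0, +oo[%classic = Rp); last first.
  by apply/seteqP; split => y; rewrite /Rp /Rplus/= in_itv/= andbT.
case: ifPn => _; last by rewrite mulr0.
rewrite mulKf ?gt_eqF// -expRM_natl; congr expR; ring.
Qed.

Lemma L2plus_not_bounded_below f (m : R) : 0 < m -> (forall x, 1 <= x -> m <= `|f x|) ->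
  ~ L2plus f.
Proof.
move=> m0 fm /L2plus_sqr fi.
have sub : `[1, +oo[%classic `<=` Rp.
  by move=> x /=; rewrite in_itv/= andbT; exact: le_trans.
have /integrableP[_] := integrableS (@measurable_Rplus R) (measurable_itv _) sub fi.
apply/negP; rewrite -leNgt.
have : ((m ^+ 2)%:E * mu `[1%R, +oo[ <= \int[mu]_(x in `[1%R, +oo[) `|(f x ^+ 2)%:E|)%E.
  rewrite -integral_cst//; apply: ge0_le_integral => //.
  - by move=> x _; rewrite lee_fin sqr_ge0.
  - apply: measurableT_comp => //.
    by have /integrableP[] := integrableS (@measurable_Rplus R) (measurable_itv _) sub fi.
  - move=> x /=; rewrite in_itv/= andbT => x1; rewrite lee_fin normrX.
    by rewrite ler_sqr ?nnegrE ?(ltW m0)//; exact: fm.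
apply: le_trans; rewrite /mu lebesgue_measure_itv/= ltry.
by rewrite addye// gt0_muley// lte_fin exprn_gt0.
Qed.

End SquareIntegrable.

(** * Derivatives relative to a set *)

Section DeriveWithin.
Variable R : realType.
Implicit Types (A B : set R) (f g : R -> R).

Lemma is_derive_withinP A f (x l : R) : is_derive_within A f x l <->
  forall e : R, 0 < e -> exists2 r : R, 0 < r & forall y, A y -> y != x -> `|x - y| < r ->
    `|l - (f y - f x) / (y - x)| <= e.
Proof.
rewrite /is_derive_within; split.
  move=> /cvgrPdist_le H e /H; rewrite near_withinE /dnbhs near_withinE.
  move=> /nbhs_ballP[r /= r0 Hr]; exists r => // y Ay yx xy.
  by apply: Hr.
move=> H; apply/cvgrPdist_le => e /H[r r0 Hr].
rewrite near_withinE /dnbhs near_withinE; apply/nbhs_ballP; exists r => //= y xy yx Ay.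
exact: Hr.
Qed.

Lemma is_derive_withinT f (x l : R) : is_derive_within setT f x l <-> is_derive x 1 f l.
Proof.
have E : (h^-1 *: ((f \o shift x) (h *: (1:R)) - f x) @[h --> (0:R)^'] --> l) <->
  is_derive_within setT f x l.
  split.
    move=> /cvgrPdist_le H; apply/is_derive_withinP => e /H.
    rewrite /dnbhs near_withinE => /nbhs_ballP[r /= r0 Hr]; exists r => // y _ yx xy.
    have := Hr (y - x); rewrite /= /GRing.scale/= mulr1 subrK mulrC; apply.
      by rewrite /ball/= sub0r opprB.
    by rewrite subr_eq0.
  move=> /is_derive_withinP H; apply/cvgrPdist_le => e /H[r r0 Hr].
  rewrite /dnbhs near_withinE; apply/nbhs_ballP; exists r => //= h; rewrite /ball/= sub0r normrN.
  move=> hr h0; have := Hr (h + x) Logic.I.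
  rewrite addrK /GRing.scale/= mulr1 mulrC; apply.
    by rewrite -subr_eq0 addrK.
  by rewrite opprD addrCA subrr addr0 normrN.
rewrite -E; split => [L|[D DE]].
  by apply: DeriveDef; [apply/cvg_ex; exists l|apply: cvg_lim].
by rewrite -DE; exact: D.
Qed.

Lemma is_derive_within_sub A B f (x l : R) : A `<=` B ->
  is_derive_within B f x l -> is_derive_within A f x l.
Proof.
move=> AB /is_derive_withinP H; apply/is_derive_withinP => e /H[r r0 Hr].
by exists r => // y Ay; apply: Hr; exact: AB.
Qed.

Lemma is_derive_is_derive_within A f (x l : R) : is_derive x 1 f l ->
  is_derive_within A f x l.
Proof. by move=> /is_derive_withinT; apply: is_derive_within_sub => y. Qed.

Lemma is_derive_within_interior A f (x l : R) : nbhs x A ->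
  is_derive_within A f x l -> is_derive x 1 f l.
Proof.
move=> /nbhs_ballP[s /= s0 sA] /is_derive_withinP H; apply/is_derive_withinT.
apply/is_derive_withinP => e /H[r r0 Hr]; exists (Num.min r s).
  by rewrite lt_min r0.
by move=> y _ yx; rewrite lt_min => /andP[yr ys]; apply: Hr => //; exact: sA.
Qed.

Lemma eq_is_derive_within A f g (x l : R) : A x -> (forall y, A y -> f y = g y) ->
  is_derive_within A f x l -> is_derive_within A g x l.
Proof.
move=> Ax fg /is_derive_withinP H; apply/is_derive_withinP => e /H[r r0 Hr].
by exists r => // y Ay yx yr; rewrite -!fg//; exact: Hr.
Qed.

Lemma is_derive_withinD A f g (x a b : R) : is_derive_within A f x a ->
  is_derive_within A g x b -> is_derive_within A (fun y => f y + g y) x (a + b).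
Proof.
move=> fa gb; rewrite /is_derive_within.
under eq_cvg do rewrite opprD addrACA mulrDl.
exact: cvgD.
Qed.

Lemma is_derive_withinZ A f (c x a : R) : is_derive_within A f x a ->
  is_derive_within A (fun y => c * f y) x (c * a).
Proof.
move=> fa; rewrite /is_derive_within.
under eq_cvg do rewrite -mulrBr -mulrA.
by apply: cvgM => //; exact: cvg_cst.
Qed.

(** Points of [A] to the right of [x] already determine the limit; this covers the end point 0 of
    R^+. *)
Lemma is_derive_within_unique A f (x d a b : R) : 0 < d -> `]x, x + d[ `<=` A ->
  is_derive_within A f x a -> is_derive_within A f x b -> a = b.
Proof.
move=> d0 dA /is_derive_withinP Ha /is_derive_withinP Hb; apply/eqP.
rewrite -subr_eq0 -normr_le0; apply/ler_addgt0Pl => e e0; rewrite addr0.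
have e20 : 0 < e / 2 by rewrite divr_gt0.
have [r r0 Hr] := Ha _ e20.
have [s s0 Hs] := Hb _ e20.
pose m := Num.min d (Num.min r s).
have m0 : 0 < m by rewrite !lt_min d0 r0.
have [md mr ms] : [/\ m <= d, m <= r & m <= s] by rewrite !ge_min !lexx !orbT.
pose y := x + m / 2.
have Ay : A y by apply: dA; rewrite /= in_itv/= /y; lra.
have yx : y != x by rewrite -subr_eq0 /y; apply: lt0r_neq0; lra.
have xy : `|x - y| = m / 2 by rewrite /y ler0_norm; lra.
have := Hr y Ay yx; rewrite xy => /(_ ltac:(lra)) H1.
have := Hs y Ay yx; rewrite xy => /(_ ltac:(lra)) H2.
have -> : a - b = (a - (f y - f x) / (y - x)) - (b - (f y - f x) / (y - x)) by lra.
by rewrite (le_trans (ler_normB _ _))//; lra.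
Qed.

(** Near [x] the difference quotient is within 1 of [l], so the increment of [f] is at most |l| + 1
    times that of the variable. *)
Lemma is_derive_within_cvg A f (x l : R) : is_derive_within A f x l ->
  f @ within A (nbhs x) --> f x.
Proof.
move=> /is_derive_withinP /(_ 1 ltr01)[r r0 Hr]; apply/cvgrPdist_le => e e0.
rewrite near_withinE; apply/nbhs_ballP.
have c0 : 0 < `|l| + 1 by rewrite ltr_wpDl.
exists (Num.min r (e / (`|l| + 1))) => /=.
  by rewrite lt_min r0 divr_gt0.
move=> y; rewrite /ball/= lt_min => /andP[yr ye] Ay.
have [->|yx] := eqVneq y x; first by rewrite subrr normr0 ltW.
have := Hr y Ay yx yr; set q := _ / _ => lq.
have -> : f x - f y = q * (x - y).
  by rewrite -opprB -[x - y]opprB mulrN /q divfK// subr_eq0.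
have {}lq : `|q| <= `|l| + 1.
  rewrite (_ : q = l - (l - q)); last lra.
  by rewrite (le_trans (ler_normB _ _))// lerD2l.
rewrite normrM (le_trans (ler_wpM2r _ lq))// mulrC -ler_pdivlMr//.
exact: ltW.
Qed.

Lemma constant_within A f (a b : R) : a <= b -> `[a, b] `<=` A ->
  {within A, continuous f} ->
  (forall x, a < x < b -> is_derive x 1 f 0) -> f b = f a.
Proof.
move=> ab abA cf D; apply/eqP; rewrite -subr_eq0; apply/eqP.
have D' x : x \in `]a, b[ -> is_derive x 1 f 0 by rewrite in_itv/=; exact: D.
have cf' : {within `[a, b], continuous f} by exact: continuous_subspaceW cf.
by have [c _ ->] := @MVT_segment R f (fun=> 0) a b ab D' cf'; rewrite mul0r.
Qed.

Lemma is_derive_within0_constant A f (a b : R) : a <= b -> `[a, b] `<=` A ->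
  (forall x, A x -> is_derive_within A f x 0) -> f b = f a.
Proof.
move=> ab abA D; apply: (@constant_within A) => //.
  by apply/subspace_continuousP => x Ax; exact: is_derive_within_cvg (D x Ax).
move=> x xab; have xin : x \in `]a, b[ by rewrite in_itv.
apply: (@is_derive_within_interior `]a, b[); first exact: near_in_itvoo.
have abA' : `]a, b[ `<=` A by move=> y yab; apply: abA; exact: subset_itv_oo_cc.
by apply: (is_derive_within_sub abA'); apply/D/abA'.
Qed.

End DeriveWithin.

(** * Uniqueness of classical solutions *)

Section ClassicalUniqueness.
Variable R : realType.
Implicit Types (w : R -> R).

(** If C is nonzero, |w| stays above the positive constant |C| (exp k - exp (- k)) on [1, oo[, which
    square integrability forbids. *)
Lemma L2plus_hyperbolic_eq0 w (k C : R) : 0 < k -> L2plus w ->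
  (forall x, Rplus R x -> w x = C * (expR (k * x) - expR (- k * x))) ->
  forall x, Rplus R x -> w x = 0.
Proof.
move=> k0 wL2 wE; suff C0 : C = 0 by move=> x x0; rewrite wE// C0 mul0r.
apply/eqP; apply: contraPT wL2 => C0.
have d0 : 0 < expR k - expR (- k) by rewrite subr_gt0 ltr_expR; lra.
apply: (@L2plus_not_bounded_below _ _ (`|C| * (expR k - expR (- k)))).
  by rewrite mulr_gt0// normr_gt0.
move=> x x1; have x0 : Rplus R x by apply: le_trans x1.
have H1 : expR k <= expR (k * x) by rewrite ler_expR ler_peMr// ltW.
have H2 : expR (- k * x) <= expR (- k) by rewrite ler_expR mulNr lerN2 ler_peMr// ltW.
rewrite wE// normrM ler_wpM2l// ger0_norm; lra.
Qed.

(** The equation w'' = k^2 w factors as (d/dx - k)(w' + k w) = 0, and exp (- k x) is the integrating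
    factor. The sign of [k] is left free. *)
Lemma hyperbolic_first_integral w w1 w2 (k : R) :
  (forall x, Rplus R x -> is_derive_within (Rplus R) w x (w1 x)) ->
  (forall x, Rplus R x -> is_derive_within (Rplus R) w1 x (w2 x)) ->
  (forall x, Rplus R x -> w2 x = k ^+ 2 * w x) ->
  forall x, Rplus R x -> (w1 x + k * w x) * expR (- k * x) = w1 0 + k * w 0.
Proof.
move=> D1 D2 E x x0.
have R0 : Rplus R 0 by exact: lexx.
pose P x := (w1 x + k * w x) * expR (- k * x).
suff : P x = P 0 by rewrite /P mulr0 expR0 mulr1.
apply: (@constant_within _ (Rplus R)) => //.
- by move=> y /=; rewrite in_itv/= => /andP[].
- apply/subspace_continuousP => y y0; apply: cvgM.
    apply: cvgD; first exact: is_derive_within_cvg (D2 y y0).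
    apply: cvgM; first exact: cvg_cst.
    exact: is_derive_within_cvg (D1 y y0).
  apply: (is_derive_within_cvg (l := - k * expR (- k * y))).
  exact/is_derive_is_derive_within/is_derive_expM.
move=> y /andP[y0 _].
have Ry : Rplus R y by exact: ltW.
have nb : nbhs y (Rplus R) by near=> z; apply: ltW; near: z; exact: lt_nbhsr.
have d1 := is_derive_within_interior nb (D1 y Ry).
have d2 := is_derive_within_interior nb (D2 y Ry).
have d3 := is_derive_expM (- k) y.
by apply: is_derive_eq; rewrite /GRing.scale/= E//; ring.
Unshelve. all: by end_near. Qed.

Lemma hyperbolic_ode w w1 w2 (k : R) : 0 < k ->
  (forall x, Rplus R x -> is_derive_within (Rplus R) w x (w1 x)) ->
  (forall x, Rplus R x -> is_derive_within (Rplus R) w1 x (w2 x)) ->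
  (forall x, Rplus R x -> w2 x = k ^+ 2 * w x) -> w 0 = 0 ->
  forall x, Rplus R x -> w x = w1 0 / (2 * k) * (expR (k * x) - expR (- k * x)).
Proof.
move=> k0 D1 D2 E w0 x x0.
have H1 := hyperbolic_first_integral D1 D2 E x0.
(* The first integral for [- k] gives w' - k w; subtracting it from w' + k w eliminates w' and
   leaves 2 k w. *)
have E' y : Rplus R y -> w2 y = (- k) ^+ 2 * w y by rewrite sqrrN; exact: E.
have H2 := hyperbolic_first_integral D1 D2 E' x0.
have e1 : expR (k * x) * expR (- k * x) = 1 by rewrite -expRD mulNr subrr expR0.
rewrite opprK w0 !mulr0 !addr0 in H1 H2.
have k20 : 2 * k != 0 by rewrite mulf_neq0// gt_eqF.
apply: (mulfI k20); rewrite mulrA [_ * (_ / _)]mulrC divfK// mulrBr.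
rewrite -{1}H1 -H2; rewrite -!mulrA [expR (- k * x) * _]mulrC e1.
ring.
Qed.

(** The equation says that the time derivative of v - gamma v_xx vanishes at each fixed x, so this
    quantity keeps its value at t = 0. *)
Lemma classical_conservation (gamma : R) (T : \bar R) (u0 : R -> R)
    (D : nat -> R -> R) (v : R -> R -> R) : (0 < T)%E ->
  Ck_derivatives 2 (Rplus R) D -> D 0%N = u0 -> classical_equation gamma T v ->
  (forall x, Rplus R x -> v x 0 = u0 x) ->
  exists vx vxx : R -> R -> R, forall t, time_interval T t -> forall x, Rplus R x ->
    [/\ is_derive_within (Rplus R) (v^~ t) x (vx x t),
        is_derive_within (Rplus R) (vx^~ t) x (vxx x t) &
        v x t - gamma * vxx x t = u0 x - gamma * D 2%N x].
Proof.
move=> T0 [DD _] D0 [vx [vxx [vt [vxxt H]]]] v0.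
have I0 : time_interval T 0 by split => //; exact: ltW.
have itvR (x : R) : Rplus R x -> `]x, x + 1[ `<=` Rplus R.
  by move=> x0 y /=; rewrite in_itv/= => /andP[/ltW + _]; exact: le_trans.
(* The space derivatives supplied by the equation and those supplied by the regularity of [u0] are
   independent witnesses; uniqueness of one-sided derivatives identifies them at t = 0. *)
have vx0 x : Rplus R x -> vx x 0 = D 1%N x.
  move=> x0; apply: (is_derive_within_unique ltr01 (itvR x x0) (f := u0)).
    have [d _ _ _ _] := H x 0 x0 I0.
    by apply: eq_is_derive_within d => //; exact: v0.
  by rewrite -D0; exact: DD.
have vxx0 x : Rplus R x -> vxx x 0 = D 2%N x.
  move=> x0; apply: (is_derive_within_unique ltr01 (itvR x x0) (f := D 1%N)).
    have [_ d _ _ _] := H x 0 x0 I0.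
    by apply: eq_is_derive_within d => //; exact: vx0.
  exact: DD.
exists vx, vxx => t It x x0; have [d1 d2 _ _ _] := H x t x0 It; split => //.
rewrite -(v0 x x0) -vxx0//.
apply: (@is_derive_within0_constant _ (time_interval T)
  (fun t => v x t - gamma * vxx x t)).
- by case: It.
- move=> s /=; rewrite in_itv/= => /andP[s0 st]; split => //.
  by case: It => _; apply: le_trans; rewrite lee_fin.
move=> s Is; have [_ _ d3 d4 <-] := H x s x0 Is.
have := is_derive_withinD d3 (is_derive_withinZ (c := - gamma) d4).
rewrite mulNr; apply: eq_is_derive_within => // y _.
by rewrite mulNr.
Qed.

End ClassicalUniqueness.

(** * Weak derivatives and time integration *)

Section WeakDerivatives.
Variable R : realType.
Let mu := @lebesgue_measure R.
Implicit Types (f g phi : R -> R).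

Lemma Rintegral_derive_compact F f (a b : R) (J : set R) :
  (forall x : R, is_derive x 1 F (f x)) -> continuous f ->
  (forall x, F x != 0 -> a <= x <= b) -> `[a, b] `<=` J ->
  \int[mu]_(x in J) f x = 0.
Proof.
move=> D cf Fab abJ.
have fab x : f x != 0 -> a <= x <= b.
  by move: x; rewrite -(is_derive_funext D); exact: (@derive1n_outside _ 1).
rewrite (@Rintegral_sub _ `[a, b])//; last first.
  by move=> x _ /fab; rewrite /= in_itv.
(* Both end points of [[- m, m]] lie strictly outside [[a, b]], where [F] is known to vanish, and
   [- m < m] holds even if [[a, b]] is empty. *)
pose m := `|a| + `|b| + 1.
have [ma mb] : - m < a /\ b < m.
  have := ler_norm (- a); rewrite normrN => H1; have := ler_norm b => H2.
  by rewrite /m; have := normr_ge0 a; have := normr_ge0 b; split; lra.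
rewrite -(@Rintegral_sub _ `[a, b] `[- m, m]).
- rewrite (smooth_FTC2 _ D) //; last first.
    by have := normr_ge0 a; have := normr_ge0 b; rewrite /m; lra.
  suff [-> ->] : F m = 0 /\ F (- m) = 0 by rewrite subrr.
  by split; apply/eqP; apply: contraT => /Fab; lra.
- by move=> x /=; rewrite !in_itv/=; lra.
- by move=> x _ /fab; rewrite /= in_itv.
Qed.

Lemma test_function_smooth phi : test_function phi -> smooth phi.
Proof. by case. Qed.

Lemma test_function_support phi k : test_function phi ->
  exists a b, 0 < a /\ forall x, derive1n k phi x != 0 -> a <= x <= b.
Proof.
by move=> [_ [a [b [a0 ab]]]]; exists a, b; split => //; exact: derive1n_outside.
Qed.

Lemma test_function_L2plus phi k : test_function phi -> L2plus (derive1n k phi).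
Proof.
move=> /[dup] /test_function_smooth sp /(test_function_support k)[a [b [a0 ab]]].
apply: (L2plus_test _ (ltW a0) ab).
exact/smooth_continuous/smooth_derive1n.
Qed.

Lemma is_weak_derivative_lin k (c : R) f f' g g' :
  L2plus f -> L2plus f' -> L2plus g -> L2plus g' ->
  is_weak_derivative k f f' -> is_weak_derivative k g g' ->
  is_weak_derivative k (fun x => f x + c * g x) (fun x => f' x + c * g' x).
Proof.
move=> Lf Lf' Lg Lg' Wf Wg phi tphi.
have mR := @measurable_Rplus R.
have lin h h' psi : L2plus h -> L2plus h' -> L2plus psi ->
    \int[mu]_(x in Rplus R) ((h x + c * h' x) * psi x) =
    \int[mu]_(x in Rplus R) (h x * psi x) + c * \int[mu]_(x in Rplus R) (h' x * psi x).
  move=> Lh Lh' Lpsi.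
  have I1 := L2plus_integrableM Lh Lpsi; have I2 := L2plus_integrableM Lh' Lpsi.
  rewrite -RintegralZl// -RintegralD//; last exact: integrableZl_EFin.
  by apply: eq_Rintegral => x _; rewrite mulrDl mulrA.
rewrite !lin//; [|exact: (test_function_L2plus 0)|exact: test_function_L2plus].
by rewrite Wf// Wg// mulrDr mulrCA.
Qed.

Lemma H2_with_lin (c : R) f f1 f2 g g1 g2 : H2_with f f1 f2 -> H2_with g g1 g2 ->
  H2_with (fun x => f x + c * g x) (fun x => f1 x + c * g1 x) (fun x => f2 x + c * g2 x).
Proof.
move=> [? ? ? ? ?] [? ? ? ? ?].
by split; try exact: L2plus_lin; exact: is_weak_derivative_lin.
Qed.

Lemma L2norm_scale (c : R) f : L2plus f -> L2norm (fun x => c * f x) = `|c| * L2norm f.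
Proof.
move=> Lf; rewrite /L2norm.
have := @LnormZ _ _ R mu 2%:E (lee1n 2) (Lfun_Sub (lee1n 2) Lf) c.
rewrite (_ : EFin \o (c \*: _) = EFin \o (fun x => c * f x) \_ (Rplus R)); last first.
  apply/funext => x /=; rewrite !patchE; case: ifPn => // _.
  by rewrite -[point]/(0 : R) scaler0.
move=> ->; rewrite fineM//=.
move/andP: Lf => [_]; rewrite inE/= /finite_norm => hlt.
by rewrite ge0_fin_numE// Lnorm_ge0.
Qed.

Lemma H2norm_scale (c : R) f f1 f2 : L2plus f -> L2plus f1 -> L2plus f2 ->
  H2norm (fun x => c * f x) (fun x => c * f1 x) (fun x => c * f2 x) =
  `|c| * H2norm f f1 f2.
Proof.
move=> Lf Lf1 Lf2; rewrite /H2norm !L2norm_scale// !exprMn -!mulrDr.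
by rewrite sqrtrM ?sqr_ge0// sqrtr_sqr normr_id.
Qed.

Lemma H2_exp (k : R) : 0 < k -> H2_with (fun x => expR (- k * x))
  (fun x => - k * expR (- k * x)) (fun x => k ^+ 2 * expR (- k * x)).
Proof.
move=> k0; have Le := L2plus_exp k0.
have Lc c : L2plus (fun x => c * expR (- k * x)).
  (* The multiple c e is written e + (c - 1) e to fit the shape of [L2plus_lin]. *)
  have := L2plus_lin (c - 1) Le Le; congr L2plus.
  by apply/funext => x; ring.
have mR := @measurable_Rplus R.
have se := @smooth_expM R (- k).
have abR (a b : R) : 0 < a -> `[a, b] `<=` Rplus R.
  by move=> a0 x /=; rewrite in_itv/= => /andP[ax _]; apply: le_trans ax; exact: ltW.
split => // phi tphi.
- have [a [b [a0 ab]]] := test_function_support 0 tphi.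
  have sp := test_function_smooth tphi.
  have D (x : R) : is_derive x 1 (fun x => expR (- k * x) * phi x)
      (expR (- k * x) * derive1 phi x - (- k * expR (- k * x) * phi x) * (-1)).
    have D1 := is_derive_expM (- k) x; have D2 := smooth_is_derive x sp.
    by apply: is_derive_eq; rewrite /GRing.scale/=; ring.
  have := Rintegral_derive_compact D _ _ (abR a b a0).
  rewrite expr1 mulN1r.
  have I1 := L2plus_integrableM Le (test_function_L2plus 1 tphi).
  have I2 := L2plus_integrableM (Lc (- k)) (test_function_L2plus 0 tphi).
  rewrite RintegralB//; last first.
    rewrite (_ : (fun x => _) = (fun x => -1 * (- k * expR (- k * x) * derive1n 0 phi x))).
      exact: integrableZl_EFin.
    by apply/funext => x; rewrite mulrC.
  rewrite RintegralZr// mulrN1 opprK => H; apply/eqP; rewrite -addr_eq0; apply/eqP/H.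
  + apply/smooth_continuous/smoothB; first exact/smoothM/smooth_derive1.
    by apply: smoothM; [apply: smoothM => //; exact: smoothZ|exact: smooth_cst].
  + by move=> x; rewrite mulf_eq0 negb_or => /andP[_]; exact: ab.
- have [a [b [a0 ab]]] := test_function_support 0 tphi.
  have [a' [b' [a'0 ab']]] := test_function_support 1 tphi.
  have sp := test_function_smooth tphi.
  (* With e = exp (- k x), this function is e phi' - e' phi, the boundary term of two integrations
     by parts; its derivative is e phi'' - e'' phi. *)
  have D (x : R) : is_derive x 1 (fun x => expR (- k * x) * (derive1 phi x + k * phi x))
      (expR (- k * x) * derive1n 2 phi x - k ^+ 2 * expR (- k * x) * phi x).
    have D1 := is_derive_expM (- k) x; have D2 := smooth_is_derive x sp.
    have D3 : is_derive x 1 (derive1 phi) (derive1n 2 phi x).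
      exact/smooth_is_derive/smooth_derive1.
    by apply: is_derive_eq; rewrite /GRing.scale/=; ring.
  have m0 : 0 < Num.min a a' by rewrite lt_min a0.
  have := Rintegral_derive_compact D _ _ (abR _ (Num.max b b') m0).
  have I1 := L2plus_integrableM Le (test_function_L2plus 2 tphi).
  have I2 := L2plus_integrableM (Lc (k ^+ 2)) (test_function_L2plus 0 tphi).
  rewrite RintegralB// sqrrN expr1n mul1r => H; apply/eqP; rewrite -subr_eq0; apply/eqP/H.
  + apply/smooth_continuous/smoothB; first by apply: smoothM => //; exact: (smooth_derive1n 2).
    by apply: smoothM => //; exact: smoothZ.
  + move=> x; rewrite mulf_eq0 negb_or => /andP[_].
    have [p0|/ab /andP[ax xb] _] := eqVneq (phi x) 0.
      rewrite p0 mulr0 addr0 => /ab'/andP[ax xb].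
      by rewrite ge_min le_max ax xb !orbT.
    by rewrite ge_min le_max ax xb.
Qed.

End WeakDerivatives.

(** * Differentiation in time under the spatial integral *)

Section TimeIntegral.
Variable R : realType.
Let mu := @lebesgue_measure R.
Variables (T : \bar R) (phi : R -> R -> R).
Hypothesis tphi : test_function2 T phi.

Lemma test_function2_slice t : test_function (fun x => partial 0 1 phi x t).
Proof.
have [d1 d2 _ [a [b [c [d [a0 c0 dT ab]]]]]] := tphi.
split; first by move=> n x; exact: (d2 n 1%N x t).
exists a, b; split => // x; apply: contraNT => xab.
rewrite /partial/= (_ : phi x = fun=> 0) ?derive1_cst//.
by apply/funext => s; apply/eqP; apply: contraT => /ab[]; rewrite (negbTE xab).
Qed.

Lemma test_function2_continuous_time i j x : continuous (partial i j phi x).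
Proof.
have [_ _ cphi _] := tphi => t.
apply: (@continuous2_cvg _ _ _ _ (nbhs t) _ (fun=> x) id _ x t (cphi i j (x, t))).
  exact: cvg_cst.
exact: cvg_id.
Qed.

Lemma test_function2_continuous_space i j t : continuous (partial i j phi ^~ t).
Proof.
have [_ _ cphi _] := tphi => x.
apply: (@continuous2_cvg _ _ _ _ (nbhs x) _ id (fun=> t) _ x t (cphi i j (x, t))).
  exact: cvg_id.
exact: cvg_cst.
Qed.

Lemma test_function2_bounded (a b c d : R) :
  exists2 C, 0 < C & forall x t, a <= x <= b -> c <= t <= d -> `|partial 0 1 phi x t| <= C.
Proof.
have [_ _ cphi _] := tphi.
have K : compact (`[a, b]%classic `*` `[c, d]%classic : set (R * R)).
  by apply: compact_setX; exact: segment_compact.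
have := compact_bounded (continuous_compact
  (continuous_subspaceT (cphi 0%N 1%N)) K).
move=> /pinfty_ex_gt0[C C0 HC]; exists C => // x t xab tcd; apply: HC.
by exists (x, t) => //; split; rewrite /= in_itv.
Qed.

Lemma L2plus_integrable_segment (w : R -> R) (a b : R) : L2plus w -> 0 <= a ->
  mu.-integrable `[a, b] (EFin \o w).
Proof.
move=> Lw a0.
have abR : `[a, b] `<=` Rplus R.
  by move=> x /=; rewrite in_itv/= => /andP[ax _]; exact: le_trans ax.
have mw : measurable_fun `[a, b] w.
  apply: (measurable_funS (@measurable_Rplus R) abR).
  apply/(measurable_restrictT _ (@measurable_Rplus R)).
  by move: Lw => /andP[]; rewrite inE.
(* This dominates |w|, because (|w| - 1)^2 >= 0. *)
have I1 : mu.-integrable `[a, b] (EFin \o (fun x => 1 + w x ^+ 2)).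
  apply: integrableD_EFin => //.
    apply: continuous_compact_integrable; first exact: segment_compact.
    by apply: continuous_subspaceT => x; exact: cvg_cst.
  exact: (integrableS (@measurable_Rplus R) _ abR (L2plus_sqr Lw)).
apply: le_integrable I1 => //; first exact/measurable_EFinP.
move=> x _; rewrite lee_fin [leRHS]ger0_norm ?addr_ge0 ?sqr_ge0//.
have := sqr_ge0 (`|w x| - 1); rewrite sqrrB expr1n mulr1 real_normK ?num_real//.
have := normr_ge0 (w x); have := sqr_ge0 (w x); lra.
Qed.

(** The inner integral is the derivative of the integral of w(x) phi(x, t) in x, a function of t
    supported in a segment inside ]0, T[. This avoids exchanging the two integrals. *)
Lemma Rintegral_test_time (w : R -> R) : L2plus w ->
  \int[mu]_(t in time_interval T) (\int[mu]_(x in Rplus R) (w x * partial 0 1 phi x t)) = 0.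
Proof.
move=> Lw.
have [d1 d2 cphi [a [b [c [d [a0 c0 dT ab]]]]]] := tphi.
have abR : `[a, b] `<=` Rplus R.
  by move=> x /=; rewrite in_itv/= => /andP[ax _]; apply: le_trans ax; exact: ltW.
have Dphi x (t : R) : is_derive t 1 (phi x) (partial 0 1 phi x t).
  apply: DeriveDef; first exact: (d1 0%N).
  by rewrite /partial/= derive1E.
have supx x t : partial 0 1 phi x t != 0 -> a <= x <= b.
  apply: contraNT => xab.
  rewrite /partial/= (_ : phi x = fun=> 0) ?derive1_cst//.
  by apply/funext => s; apply/eqP; apply: contraT => /ab[]; rewrite (negbTE xab).
(* On the segment a multiple of |w| is an integrable majorant; a square integrable [w] need not be
   integrable on all of R^+. *)
pose F t := \int[mu]_(x in `[a, b]) (w x * phi x t).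
pose G t := \int[mu]_(x in `[a, b]) (w x * partial 0 1 phi x t).
have GE t : \int[mu]_(x in Rplus R) (w x * partial 0 1 phi x t) = G t.
  apply: Rintegral_sub abR _ => x _; rewrite mulf_eq0 negb_or => /andP[_ /supx].
  by rewrite /= in_itv.
under eq_Rintegral do rewrite GE.
have Iw := L2plus_integrable_segment b Lw (ltW a0).
have Iwphi t : mu.-integrable `[a, b] (EFin \o (fun x => w x * phi x t)).
  apply: (integrableS (@measurable_Rplus R)) abR _ => //.
  apply: L2plus_integrableM => //.
  apply: (@L2plus_test _ (phi ^~ t) a b _ (ltW a0)).
    exact: (@test_function2_continuous_space 0 0 t).
  by move=> x /ab[].
have Iwpsi t : mu.-integrable `[a, b] (EFin \o (fun x => w x * partial 0 1 phi x t)).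
  apply: (integrableS (@measurable_Rplus R)) abR _ => //.
  apply: L2plus_integrableM => //.
  exact: (test_function_L2plus 0 (test_function2_slice t)).
have IwC C : mu.-integrable `[a, b] (EFin \o (fun x => C * `|w x|)).
  by apply: integrableZl_EFin => //; exact: integrable_norm.
have bound t : exists2 C, 0 < C & forall s x, `]t - 1, t + 1[%classic s -> `[a, b]%classic x ->
    `|w x * partial 0 1 phi x s| <= C * `|w x|.
  have [C C0 HC] := test_function2_bounded a b (t - 1) (t + 1); exists C => // s x.
  rewrite /= !in_itv/= => sI xI; rewrite normrM mulrC ler_wpM2r// HC//; lra.
have inI (t : R) : `]t - 1, t + 1[%classic t.
  by rewrite /= in_itv/= ltrBlDr !ltrDl ltr01.
have Dw (x s : R) : is_derive s 1 (fun t => w x * phi x t) (w x * partial 0 1 phi x s).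
  by have D := Dphi x s; apply: is_derive_eq; rewrite /GRing.scale/=; ring.
have d1E (x s : R) : partial1of2 (fun t x => w x * phi x t) s x = w x * partial 0 1 phi x s.
  by rewrite partial1of2E; case: (Dw x s).
have DF (t : R) : is_derive t 1 F (G t).
  have [C C0 HC] := bound t.
  have mab : measurable (`[a, b]%classic : set (measurableTypeR R)) by [].
  have ge0C x : 0 <= C * `|w x| by rewrite mulr_ge0// ltW.
  have HC' s x : `]t - 1, t + 1[%classic s -> `[a, b]%classic x ->
     `|partial1of2 (fun t x => w x * phi x t) s x| <= C * `|w x|.
    by rewrite d1E; exact: HC.
  have der s x : `]t - 1, t + 1[%classic s -> `[a, b]%classic x ->
     derivable ((fun t x => w x * phi x t) ^~ x) s 1.
    by move=> _ _; case: (Dw x s).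
  have dE : \int[mu]_(x in `[a, b]) partial1of2 (fun t x => w x * phi x t) t x = G t.
    by apply: eq_Rintegral => x _; exact: d1E.
  have L : h^-1 *: (F (h + t) - F t) @[h --> (0:R)^'] --> G t.
    rewrite -dE.
    exact: (@cvg_differentiation_under_integral R _ _ mu (fun t x => w x * phi x t)
      `[a, b] mab t _ _ (inI t) (fun s _ => Iwphi s) der
      (fun x => C * `|w x|) ge0C (IwC C) HC').
  apply: DeriveDef.
    by apply/cvg_ex; exists (G t); under eq_fun do rewrite scaler1.
  by apply/cvg_lim => //; under eq_fun do rewrite scaler1.
have cG : continuous G.
  move=> t; have [C C0 HC] := bound t.
  apply: (@continuity_under_integral R _ _ mu (fun t x => w x * partial 0 1 phi x t)
    `[a, b] _ (t - 1) (t + 1) _ _ (fun x => C * `|w x|)) => //.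
  - apply: aeW => x _ s _; apply: cvgM; first exact: cvg_cst.
    exact: test_function2_continuous_time.
  - by move=> s sI; apply: aeW => x xI; exact: HC.
  - exact/mem_set/inI.
apply: (@Rintegral_derive_compact _ F G c d) => //.
- move=> t; apply: contraNT => tcd; apply/eqP.
  have -> : F t = \int[mu]_(x in `[a, b]) (cst 0 x).
    apply: eq_Rintegral => x _; suff -> : phi x t = 0 by rewrite mulr0.
    by apply/eqP; apply: contraT => /ab[_]; rewrite (negbTE tcd).
  by rewrite Rintegral_cst// mul0r.
- move=> t /=; rewrite in_itv/= => /andP[ct td]; split.
    by apply: le_trans ct; exact: ltW.
  by apply: (le_trans _ (ltW dT)); rewrite lee_fin.
Qed.

End TimeIntegral.

(** * Conservation law for distributional solutions *)

Section DistributionalUniqueness.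
Variable R : realType.
Let mu := @lebesgue_measure R.

(* X is the convolution of rho with the Green function of 1 - d^2/dx^2 / k^2
   that vanishes on the left; a combination of translates of X has compact
   support iff the exponentials cancel on the right. *)
Lemma green_primitive (k h : R) (rho : R -> R) : 0 < k -> 0 <= h -> smooth rho ->
  (forall x, x <= 0 -> rho x = 0) -> (forall x, h <= x -> rho x = 0) ->
  exists X (alpha beta : R), [/\ smooth X, (forall x, x <= 0 -> X x = 0),
    (forall x, h <= x -> X x = alpha * expR (k * x) + beta * expR (- k * x)) &
    forall x, X x - (k ^+ 2)^-1 * derive1n 2 X x = rho x].
Proof.
move=> k0 h0 sr rho0 rhoh.
have prim c : exists2 A : R -> R, smooth A /\
    (forall x : R, is_derive x 1 A (expR (c * x) * rho x)) &
    (forall x, x <= 0 -> A x = 0) /\ (forall x, h <= x -> A x = A h).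
  have se : smooth (fun x => expR (c * x) * rho x) by apply: smoothM => //; exact: smooth_expM.
  have [x x0|A DA A0] := primitive_halfline (smooth_continuous se).
    by rewrite rho0// mulr0.
  exists A; split => //; first exact: smooth_primitive DA.
  move=> x hx; apply: (is_derive0_eq DA hx) => y /andP[hy _].
  by rewrite rhoh// mulr0.
have [P [sP DP] [P0 Ph]] := prim (- k); have [N [sN DN] [N0 Nh]] := prim k.
have e1 x : expR (k * x) * expR (- k * x) = 1 by rewrite -expRD mulNr subrr expR0.
(* Variation of parameters: X(x) is - k times the integral of sinh (k (x - y)) rho(y) over y <= x,
   with sinh split into exponentials. Beyond [h] the primitives [P] and [N] are constant, which
   yields [alpha] and [beta]. *)
pose c := - (k / 2).
pose X x := c * (expR (k * x) * P x - expR (- k * x) * N x).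
pose X1 x := c * k * (expR (k * x) * P x + expR (- k * x) * N x).
have DX (x : R) : is_derive x 1 X (X1 x).
  have D1 := DP x; have D2 := DN x.
  have D3 := is_derive_expM k x; have D4 := is_derive_expM (- k) x.
  apply: is_derive_eq; rewrite /X1 /GRing.scale/=.
  have E1 : expR (k * x) * (expR (- k * x) * rho x) = rho x by rewrite mulrA e1 mul1r.
  have E2 : expR (- k * x) * (expR (k * x) * rho x) = rho x.
    by rewrite mulrA [_ * expR (k * x)]mulrC e1 mul1r.
  by rewrite E1 E2; ring.
have DX1 (x : R) : is_derive x 1 X1 (k ^+ 2 * (X x - rho x)).
  have D1 := DP x; have D2 := DN x.
  have D3 := is_derive_expM k x; have D4 := is_derive_expM (- k) x.
  apply: is_derive_eq; rewrite /X /GRing.scale/=.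
  have E1 : expR (k * x) * (expR (- k * x) * rho x) = rho x by rewrite mulrA e1 mul1r.
  have E2 : expR (- k * x) * (expR (k * x) * rho x) = rho x.
    by rewrite mulrA [_ * expR (k * x)]mulrC e1 mul1r.
  by rewrite E1 E2 /c; field.
exists X, (c * P h), (- c * N h); split.
- apply: smoothZ; apply: smoothB; apply: smoothM => //; exact: smooth_expM.
- by move=> x x0; rewrite /X P0// N0// !mulr0 subrr mulr0.
- by move=> x hx; rewrite /X (Ph x)// (Nh x)//; ring.
move=> x; have -> : derive1n 2 X = derive1 (derive1 X) by [].
rewrite (is_derive_funext DX).
rewrite (is_derive_funext DX1) mulKf; last by rewrite expf_neq0// gt_eqF.
ring.
Qed.

Variables (M : R -> R) (smooth_M : smooth M) (M_ge0 : forall x, 0 <= derive1 M x).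
Hypothesis M0 : forall x, x <= 0 -> M x = 0.
Hypothesis M1 : forall x, 1 <= x -> M x = 1.

(** Translates of one profile share the coefficients [alpha] and [beta] of [green_primitive], so the
    cancellation conditions do not depend on [n]. *)
Lemma bump_shift n a x : bump M n a x = bump M n 0 (1 * x + - a).
Proof.
have D (y : R) : is_derive y 1 (step M n a) (1 * bump M n 0 (1 * y + - a)).
  rewrite (_ : step M n a = fun x => step M n 0 (1 * x + - a)).
    by apply: is_derive_affine; exact: is_derive_step.
  by apply/funext => z; rewrite /step mulr0 subr0 mul1r mulrBr.
by rewrite {1}/bump (is_derive_funext D) mul1r.
Qed.

(** The set where a continuous function is nonzero is open, so it misses the end points of the
    closed support; [green_primitive] wants zeros at both ends. *)
Lemma bump_support_strict n a x : bump M n a x != 0 -> a < x < a + n.+1%:R^-1.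
Proof.
move=> bx; have cb := smooth_continuous (smooth_bump smooth_M n a).
have : \forall y \near x, bump M n a y != 0 by apply: (cvgr_neq0 _ (cb x)).
move=> /nbhs_ballP[r /= r0 Hr].
have r20 : (0 : R) < r / 2 by rewrite divr_gt0.
have [/bump_support H1 /bump_support H2] : bump M n a (x - r / 2) != 0 /\
    bump M n a (x + r / 2) != 0.
  split; apply: Hr; rewrite /ball/=.
    by rewrite opprB addrCA subrr addr0 gtr0_norm// gtr_pMr// invf_lt1// ltr1n.
  by rewrite opprD addrA subrr add0r normrN gtr0_norm// gtr_pMr// invf_lt1// ltr1n.
have /andP[h1 _] := H1 M0 M1; have /andP[_ h2] := H2 M0 M1.
by rewrite (le_lt_trans h1) ?ltrBlDr ?ltrDl// (lt_le_trans _ h2) ?ltrDl.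
Qed.

Lemma bump_eq0 n a x : ~~ (a < x < a + n.+1%:R^-1) -> bump M n a x = 0.
Proof. by move=> H; apply/eqP; apply: contraNT H; exact: bump_support_strict. Qed.

Variables (k gamma : R) (k_gt0 : 0 < k) (gammaE : gamma * k ^+ 2 = 1).

Lemma combination_test_function n (a1 a2 a3 c1 c2 c3 : R) :
  0 < a1 -> 0 < a2 -> 0 < a3 ->
  c1 * expR (k * a1) + c2 * expR (k * a2) + c3 * expR (k * a3) = 0 ->
  c1 * expR (- k * a1) + c2 * expR (- k * a2) + c3 * expR (- k * a3) = 0 ->
  exists2 chi, test_function chi & forall x, chi x - gamma * derive1n 2 chi x =
    c1 * bump M n a1 x + c2 * bump M n a2 x + c3 * bump M n a3 x.
Proof.
move=> a10 a20 a30 Cp Cm.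
have k2 : k ^+ 2 != 0 by rewrite expf_neq0// gt_eqF.
have gE : gamma = (k ^+ 2)^-1 by apply: (mulIf k2); rewrite gammaE mulVf.
pose h : R := n.+1%:R^-1.
have h0 : 0 < h by rewrite /h.
have sb : smooth (bump M n 0) by exact: smooth_bump.
have b0 x : x <= 0 -> bump M n 0 x = 0.
  by move=> x0; apply: bump_eq0; rewrite negb_and -!leNgt x0.
have bh x : h <= x -> bump M n 0 x = 0.
  by move=> hx; apply: bump_eq0; rewrite negb_and -!leNgt add0r hx orbT.
have [X [al [be [sX X0 Xh EX]]]] := green_primitive k_gt0 (ltW h0) sb b0 bh.
pose Y (c a x : R) := c * X (1 * x + - a).
have sY c a : smooth (Y c a) by apply: smoothZ; exact: smooth_affine.
have shift1 (g : R -> R) (a : R) : smooth g ->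
    derive1 (fun x => g (1 * x + - a)) = fun x => derive1 g (1 * x + - a).
  move=> sg; apply: is_derive_funext => z.
  by have := is_derive_affine (smooth_is_derive (1 * z + - a) sg); rewrite mul1r.
have DY c a : derive1n 2 (Y c a) = fun x => c * derive1n 2 X (1 * x + - a).
  rewrite /Y derive1nZ; last exact: smooth_affine.
  suff -> : derive1n 2 (fun x => X (1 * x + - a)) = fun x => derive1n 2 X (1 * x + - a) by [].
  rewrite derive1nS derive1n1 (shift1 _ _ sX).
  exact: (shift1 _ _ (smooth_derive1 sX)).
have YE c a x : Y c a x = c * X (1 * x + - a) by [].
move: Y YE sY DY => Y YE sY DY.
have s12 : smooth (fun x => Y c1 a1 x + Y c2 a2 x) by exact: smoothD.
exists (fun x => Y c1 a1 x + Y c2 a2 x + Y c3 a3 x); last first.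
  move=> x; rewrite (derive1nD 2 s12 (sY c3 a3)) (derive1nD 2 (sY c1 a1) (sY c2 a2)).
  rewrite !DY !YE (bump_shift n a1) (bump_shift n a2) (bump_shift n a3) -!EX -gE.
  move: (derive1n 2 X (1 * x + - a1)) (derive1n 2 X (1 * x + - a2)).
  move: (derive1n 2 X (1 * x + - a3)) => *; ring.
split; first by case: (smoothD s12 (sY c3 a3)).
(* As the points are positive, their sum dominates each of them: past this bound all three
   translates are pure exponentials, and these cancel by [Cp] and [Cm]. *)
exists (Num.min a1 (Num.min a2 a3)), (a1 + a2 + a3 + h); split.
  by rewrite !lt_min a10 a20.
move=> x; apply: contraNT; rewrite negb_and -!ltNge => /orP[|].
  rewrite !lt_min => /and3P[x1 x2 x3].
  by rewrite !YE !X0 ?mulr0 ?addr0// mul1r subr_le0 ltW.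
move=> hx; rewrite !YE !Xh ?mul1r; try lra.
have Ep (a : R) : expR (k * (x + - a)) = expR (k * x) * expR (- k * a).
  by rewrite -expRD; congr expR; ring.
have Em (a : R) : expR (- k * (x + - a)) = expR (- k * x) * expR (k * a).
  by rewrite -expRD; congr expR; ring.
rewrite !Ep !Em; apply/eqP.
transitivity (al * expR (k * x) *
  (c1 * expR (- k * a1) + c2 * expR (- k * a2) + c3 * expR (- k * a3)) +
  be * expR (- k * x) *
  (c1 * expR (k * a1) + c2 * expR (k * a2) + c3 * expR (k * a3))); first ring.
by rewrite Cp Cm !mulr0 addr0.
Qed.

End DistributionalUniqueness.

(** * Conserved pairings of a distributional solution *)

Section DistributionalConservation.
Variable R : realType.
Let mu := @lebesgue_measure R.

Lemma tensor_partial (chi eta : R -> R) i j : smooth chi -> smooth eta -> forall x t,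
  partial i j (fun x t => chi x * eta t) x t = derive1n i chi x * derive1n j eta t.
Proof.
move=> sc se x t; rewrite /partial.
rewrite (_ : (fun y => _) = fun y => derive1n j eta t * chi y).
  by rewrite derive1nZ// mulrC.
by apply/funext => y; rewrite derive1nZ// mulrC.
Qed.

Lemma tensor_test_function2 (T : \bar R) (chi eta : R -> R) (c d : R) :
  test_function chi -> smooth eta -> 0 < c -> (d%:E < T)%E ->
  (forall t, eta t != 0 -> c <= t <= d) ->
  test_function2 T (fun x t => chi x * eta t).
Proof.
move=> tchi se c0 dT etacd; have sc := test_function_smooth tchi; split.
- move=> j x t; rewrite derive1nZ//.
  have D := smooth_is_derive t (smoothZ (chi x) (smooth_derive1n j se)).
  by case: D.
- move=> i j x t.
  rewrite (_ : _ ^~ t = fun x => derive1n j eta t * derive1n i chi x).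
    have D := smooth_is_derive x (smoothZ (derive1n j eta t) (smooth_derive1n i sc)).
    by case: D.
  by apply/funext => y; rewrite tensor_partial// mulrC.
- move=> i j; rewrite (_ : (fun p => _) = fun p => derive1n i chi p.1 * derive1n j eta p.2).
    move=> [x t] /=; apply: cvgM.
      apply: (@cvg_comp _ _ _ fst (derive1n i chi)); first exact: cvg_fst.
      exact: (smooth_continuous (smooth_derive1n i sc)).
    apply: (@cvg_comp _ _ _ snd (derive1n j eta)); first exact: cvg_snd.
    exact: (smooth_continuous (smooth_derive1n j se)).
  by apply/funext => p; rewrite tensor_partial.
- have [_ [a [b [a0 ab]]]] := tchi.
  exists a, b, c, d; split => // x t; rewrite mulf_eq0 negb_or => /andP[cx et].
  by split; [exact: ab|exact: etacd].
Qed.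

Variables (T : \bar R) (T_gt0 : (0 < T)%E) (v : R -> R -> R).
Hypothesis vH2 : C_H2 (time_interval T) v.

Lemma C_H2_L2plus t : time_interval T t -> L2plus (v^~ t).
Proof. by have [v1 [v2 [H _]]] := vH2 => /H[]. Qed.

(** The H^2 norm dominates the L^2 norm, and Cauchy-Schwarz bounds the increment of the pairing. *)
Lemma C_H2_pairing_continuous psi : L2plus psi ->
  {within time_interval T, continuous (fun t => \int[mu]_(x in Rplus R) (v x t * psi x))}.
Proof.
move=> Lpsi; apply/subspace_continuousP => s Is.
have [v1 [v2 [Hv /(_ s Is) cv]]] := vH2.
set N := (X in X @ _ --> _) in cv.
apply/cvgrPdist_le => e e0.
(* Adding 1 keeps the divisor positive when [psi] is null. *)
have K0 : 0 < L2norm psi + 1 by rewrite ltr_wpDl// L2norm_ge0.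
have := cvgr0_norm_le _ cv; move=> /(_ _ (e / (L2norm psi + 1)) (divr_gt0 e0 K0)).
rewrite !near_withinE; apply: filterS => t Ht It.
have {Ht} := Ht It; rewrite ger0_norm ?sqrtr_ge0// => Nt.
have Lt := C_H2_L2plus It; have Ls := C_H2_L2plus Is.
have Ld : L2plus (fun x => v x t - v x s).
  by have := L2plus_lin (-1) Lt Ls; congr L2plus; apply/funext => x; rewrite mulN1r.
rewrite distrC -RintegralB; last 3 first.
- exact: measurable_Rplus.
- exact: L2plus_integrableM.
- exact: L2plus_integrableM.
rewrite (@eq_Rintegral _ _ _ mu _ (fun x => (v x t - v x s) * psi x)); last first.
  by move=> x _; rewrite mulrBl.
apply: (le_trans (L2norm_CauchySchwarz Ld Lpsi)).
apply: (@le_trans _ _ (e / (L2norm psi + 1) * L2norm psi)).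
  apply: ler_wpM2r; first exact: L2norm_ge0.
  by apply: le_trans Nt; exact: L2norm_le_H2norm.
by rewrite -mulrA ler_piMr ?ltW// mulrC ltr_pdivrMr// mul1r ltrDl.
Qed.

Variables (M : R -> R) (smooth_M : smooth M) (M_ge0 : forall x, 0 <= derive1 M x).
Hypothesis M0 : forall x, x <= 0 -> M x = 0.
Hypothesis M1 : forall x, 1 <= x -> M x = 1.
Variables (gamma : R).
Hypothesis v_eq : distributional_equation gamma T v.

Let pairing (chi : R -> R) t :=
  \int[mu]_(x in Rplus R) (v x t * (chi x - gamma * derive1n 2 chi x)).

Lemma L2plus_helmholtz chi : test_function chi ->
  L2plus (fun x => chi x - gamma * derive1n 2 chi x).
Proof.
move=> tchi.
have := L2plus_lin (- gamma) (test_function_L2plus 0 tchi) (test_function_L2plus 2 tchi).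
by congr L2plus; apply/funext => x; rewrite mulNr.
Qed.

(** Testing the equation with chi(x) eta(t) shows that the pairing has zero weak derivative on ]0,
    T[. *)
Lemma pairing_orthogonal chi eta (c d : R) : test_function chi -> smooth eta ->
  0 < c -> (d%:E < T)%E -> (forall t, eta t != 0 -> c <= t <= d) ->
  \int[mu]_(t in time_interval T) (pairing chi t * derive1 eta t) = 0.
Proof.
move=> tchi se c0 dT etacd; have sc := test_function_smooth tchi.
have H := v_eq (tensor_test_function2 tchi se c0 dT etacd).
have mR := @measurable_Rplus R.
have E t : time_interval T t -> \int[mu]_(x in Rplus R) (v x t *
    (- (partial 0 1 (fun x t => chi x * eta t) x t -
        gamma * partial 2 1 (fun x t => chi x * eta t) x t))) =
    -1 * (pairing chi t * derive1 eta t).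
  move=> It; rewrite mulrC -mulrA -RintegralZr//; last first.
    by apply: L2plus_integrableM (L2plus_helmholtz tchi); exact: C_H2_L2plus.
  apply: eq_Rintegral => x _; rewrite !tensor_partial// derive1n1 derive1n0.
  move: (derive1n 2 chi x) => *; ring.
have : \int[mu]_(t in time_interval T) (-1 * (pairing chi t * derive1 eta t)) = 0.
  by rewrite -[RHS]H; apply: eq_Rintegral => t /set_mem /E ->.
have mI := @measurable_time_interval R T.
have cse := smooth_continuous (smooth_derive1 se).
rewrite RintegralZl//; first by move/eqP; rewrite mulf_eq0 oppr_eq0 oner_eq0 => /eqP.
apply: (@test_mul_integrable _ _ _ _ c d) => //.
- exact: C_H2_pairing_continuous (L2plus_helmholtz tchi).
- move=> t /=; rewrite in_itv/= => /andP[ct td]; split.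
    by apply: le_trans ct; exact: ltW.
  by apply: (le_trans _ (ltW dT)); rewrite lee_fin.
- exact: (@derive1n_outside _ 1).
Qed.

Lemma pairing_constant_inside chi (s r : R) : test_function chi ->
  0 < s -> 0 < r -> (s%:E < T)%E -> (r%:E < T)%E -> pairing chi s = pairing chi r.
Proof.
move=> tchi s0 r0 sT rT.
(* Bumps extend to the right of their base point, so room is needed between both times and [T]. *)
have [d d0 [sd rd]] : exists2 d : R, 0 < d & ((s + d)%:E < T)%E /\ ((r + d)%:E < T)%E.
  case: T sT rT => [T'| |] //; last by exists 1 => //; rewrite !ltry.
  rewrite !lte_fin => sT rT; exists ((T' - Num.max s r) / 2).
    by rewrite divr_gt0// subr_gt0 gt_max sT.
  have : s <= Num.max s r /\ r <= Num.max s r by rewrite !le_max !lexx orbT.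
  have : Num.max s r < T' by rewrite gt_max sT.
  by move: (Num.max s r) => m mT [sm rm]; rewrite !lte_fin; split; lra.
have cp := C_H2_pairing_continuous (L2plus_helmholtz tchi).
have mI := @measurable_time_interval R T.
have sub z : 0 < z -> ((z + d)%:E < T)%E -> `[z, z + d] `<=` time_interval T.
  move=> z0 zT t /=; rewrite in_itv/= => /andP[zt td]; split.
    by apply: le_trans zt; exact: ltW.
  by apply: (le_trans _ (ltW zT)); rewrite lee_fin.
pose J z n := \int[mu]_(t in time_interval T) (pairing chi t * bump M n z t).
have Ls : J s n @[n --> \oo] --> pairing chi s.
  exact: (cvg_bump smooth_M M_ge0 M0 M1 mI cp d0 (sub s s0 sd)).
have Lr : J r n @[n --> \oo] --> pairing chi r.
  exact: (cvg_bump smooth_M M_ge0 M0 M1 mI cp d0 (sub r r0 rd)).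
suff E : \forall n \near \oo, J r n = J s n.
  have Lr' : J s n @[n --> \oo] --> pairing chi r.
    exact: (cvg_trans (near_eq_cvg E) Lr).
  by rewrite -(cvg_lim (@Rhausdorff R) Ls) (cvg_lim (@Rhausdorff R) Lr').
near=> n.
have nd : n.+1%:R^-1 < d by near: n; exact: near_infty_natSinv_lt (PosNum d0).
(* Both steps end at 1, so their difference has compact support, as a single step does not; in the
   limit its derivative evaluates the pairing at [r] minus the pairing at [s]. *)
have se : smooth (fun t => step M n r t - step M n s t).
  by apply: smoothB; exact: smooth_step.
have Deta : derive1 (fun t => step M n r t - step M n s t) =
    fun t => bump M n r t - bump M n s t.
  by apply: is_derive_funext => t; apply: is_deriveB; exact: is_derive_step.
have mx : ((Num.max s r + d)%:E < T)%E by rewrite /Num.max; case: ifP.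
have := @pairing_orthogonal chi _ (Num.min s r) _ tchi se _ mx _.
rewrite Deta lt_min s0 r0 => /(_ isT) H.
have {}H : \int[mu]_(t in time_interval T)
    (pairing chi t * (bump M n r t - bump M n s t)) = 0.
  apply: H => t; apply: contraNT; rewrite negb_and -!ltNge => /orP[|].
    by rewrite lt_min => /andP[ts tr]; rewrite !step_le ?subrr// ltW.
  move=> tm; have [ts tr] : s + d < t /\ r + d < t.
    by split; apply: le_lt_trans tm; rewrite lerD2r le_max lexx ?orbT.
  by rewrite !step_ge ?subrr//; [apply: (le_trans _ (ltW ts))|apply: (le_trans _ (ltW tr))];
    rewrite lerD2l ltW.
have int z : 0 < z -> ((z + d)%:E < T)%E ->
    mu.-integrable (time_interval T) (EFin \o (fun t => pairing chi t * bump M n z t)).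
  move=> z0 zT; apply: (@test_mul_integrable _ _ _ _ z (z + d)) => //.
  - exact/smooth_continuous/smooth_bump.
  - exact: sub.
  - move=> t /(bump_support M0 M1)/andP[-> tz]; apply: (le_trans tz).
    by rewrite lerD2l ltW.
apply/eqP; rewrite /J -subr_eq0 -RintegralB ?int//; apply/eqP; rewrite -[RHS]H.
by apply: eq_Rintegral => t _; rewrite mulrBr.
Unshelve. all: by end_near. Qed.

Lemma pairing_conserved chi t : test_function chi -> time_interval T t ->
  pairing chi t = pairing chi 0.
Proof.
move=> tchi.
have [m m0 mT] : exists2 m : R, 0 < m & (m%:E < T)%E.
  case: T T_gt0 => [T'| |] //; last by exists 1 => //; rewrite ltry.
  by rewrite lte_fin => T0; exists (T' / 2); rewrite ?lte_fin; lra.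
have /subspace_continuousP cp := C_H2_pairing_continuous (L2plus_helmholtz tchi).
suff H s : time_interval T s -> pairing chi s = pairing chi m.
  by move=> It; rewrite !H//; split => //; exact: ltW.
move=> Is; apply/eqP; rewrite -subr_eq0 -normr_le0; apply/ler_addgt0Pl => e e0.
rewrite addr0.
have := cp s Is; move=> /cvgrPdist_le /(_ e e0); rewrite near_withinE.
move=> /nbhs_ballP[q /= q0 Hq].
(* A nearby interior time: to the right of [s] if s = 0, otherwise to its left, which also covers s
   = T. *)
have [y [y0 yT ys]] : exists y : R, [/\ 0 < y, (y%:E < T)%E & `|s - y| < q].
  have [s0 sT] := Is.
  move: s0; rewrite le_eqVlt => /orP[/eqP <-|s0].
    exists (Num.min m (q / 2)); split.
    - by rewrite lt_min m0 divr_gt0.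
    - by apply: le_lt_trans mT; rewrite lee_fin ge_min lexx.
    rewrite sub0r normrN gtr0_norm ?lt_min ?m0 ?divr_gt0//.
    by rewrite gt_min gtr_pMr// invf_lt1// ltr1n orbT.
  pose z : R := Num.min (s / 2) (q / 2).
  have z0 : 0 < z by rewrite lt_min !divr_gt0.
  have zq : z < q by rewrite gt_min gtr_pMr// invf_lt1// ltr1n orbT.
  have zs : z < s by rewrite gt_min gtr_pMr// invf_lt1// ltr1n.
  exists (s - z); split.
  - by rewrite subr_gt0.
  - by apply: lt_le_trans sT; rewrite lte_fin ltrBlDr ltrDl.
  - by rewrite opprB addrCA subrr addr0 gtr0_norm.
have Iy : time_interval T y by split; exact: ltW.
by rewrite -(pairing_constant_inside tchi y0 m0 yT mT); exact: Hq.
Qed.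

Variables (k : R) (k_gt0 : 0 < k) (gammaE : gamma * k ^+ 2 = 1).
Hypothesis v_cont : forall t, time_interval T t -> {within Rplus R, continuous (v^~ t)}.

(** The same weights are admissible for every [n], so the bump averages agree at times [t] and 0 for
    every [n]; continuity in x turns their limits into point values. *)
Lemma combination_conserved t (a1 a2 a3 c1 c2 c3 : R) : time_interval T t ->
  0 < a1 -> 0 < a2 -> 0 < a3 ->
  c1 * expR (k * a1) + c2 * expR (k * a2) + c3 * expR (k * a3) = 0 ->
  c1 * expR (- k * a1) + c2 * expR (- k * a2) + c3 * expR (- k * a3) = 0 ->
  c1 * v a1 t + c2 * v a2 t + c3 * v a3 t = c1 * v a1 0 + c2 * v a2 0 + c3 * v a3 0.
Proof.
move=> It a10 a20 a30 Cp Cm.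
have mR := @measurable_Rplus R.
have I0 : time_interval T 0 by split => //; exact: ltW.
have aR a : 0 < a -> `[a, a + 1] `<=` Rplus R.
  by move=> a0 x /=; rewrite in_itv/= => /andP[ax _]; apply: le_trans ax; exact: ltW.
pose J s n a := \int[mu]_(x in Rplus R) (v x s * bump M n a x).
pose K s n := c1 * J s n a1 + c2 * J s n a2 + c3 * J s n a3.
have L s : time_interval T s ->
    K s n @[n --> \oo] --> c1 * v a1 s + c2 * v a2 s + c3 * v a3 s.
  move=> Is; have cv := v_cont Is.
  have La a (a0 : 0 < a) := cvg_bump smooth_M M_ge0 M0 M1 mR cv ltr01 (aR a a0).
  by apply: cvgD; [apply: cvgD|]; apply: cvgM; do ?[exact: cvg_cst|exact: La].
suff E : \forall n \near \oo, K 0 n = K t n.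
  have L0 : K t n @[n --> \oo] --> c1 * v a1 0 + c2 * v a2 0 + c3 * v a3 0.
    exact: (cvg_trans (near_eq_cvg E) (L 0 I0)).
  by rewrite -(cvg_lim (@Rhausdorff R) (L t It)) (cvg_lim (@Rhausdorff R) L0).
near=> n; rewrite /K.
have [chi tchi chiE] := combination_test_function smooth_M M0 M1 k_gt0 gammaE n a10 a20 a30 Cp Cm.
have := pairing_conserved tchi It; rewrite /pairing.
have JE s : time_interval T s ->
    \int[mu]_(x in Rplus R) (v x s * (chi x - gamma * derive1n 2 chi x)) =
    c1 * J s n a1 + c2 * J s n a2 + c3 * J s n a3.
  move=> Is; have Lv := C_H2_L2plus Is.
  have Ib a : 0 < a -> mu.-integrable (Rplus R) (EFin \o (fun x => v x s * bump M n a x)).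
    move=> a0; apply: L2plus_integrableM Lv _.
    have supp x : bump M n a x != 0 -> a <= x <= a + n.+1%:R^-1 by exact: bump_support.
    apply: (L2plus_test _ (ltW a0) supp).
    exact/smooth_continuous/smooth_bump.
  have Ic c a : 0 < a ->
      mu.-integrable (Rplus R) (EFin \o (fun x => c * (v x s * bump M n a x))).
    by move=> a0; apply: integrableZl_EFin => //; exact: Ib.
  rewrite /K /J -!RintegralZl ?Ib// -(RintegralD mR (Ic c1 a1 a10) (Ic c2 a2 a20)).
  have I12 := integrableD_EFin mR (Ic c1 a1 a10) (Ic c2 a2 a20).
  rewrite -(RintegralD mR I12 (Ic c3 a3 a30)).
  by apply: eq_Rintegral => x _; rewrite chiE; ring.
by rewrite (JE t It) (JE 0 I0).
Unshelve. all: by end_near. Qed.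

End DistributionalConservation.

(** * The initial- and boundary-value problem *)

Lemma hyperbolic_interpolation (R : realType) (w : R -> R) (k : R) : 0 < k ->
  {within Rplus R, continuous w} -> w 0 = 0 ->
  (forall a1 a2 a3 c1 c2 c3 : R, 0 < a1 -> 0 < a2 -> 0 < a3 ->
    c1 * expR (k * a1) + c2 * expR (k * a2) + c3 * expR (k * a3) = 0 ->
    c1 * expR (- k * a1) + c2 * expR (- k * a2) + c3 * expR (- k * a3) = 0 ->
    c1 * w a1 + c2 * w a2 + c3 * w a3 = 0) ->
  exists C, forall x, Rplus R x -> w x = C * (expR (k * x) - expR (- k * x)).
Proof.
move=> k0 /subspace_continuousP cw w0 H.
pose S z := expR (k * z) - expR (- k * z).
have S0 : S 0 = 0 by rewrite /S !mulr0 subrr.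
have S1 : S 1 != 0 by rewrite subr_eq0 gt_eqF// ltr_expR !mulr1; lra.
have cS z : {for z, continuous S}.
  apply: cvgB; first exact: (smooth_continuous (smooth_expM k)).
  exact: (smooth_continuous (smooth_expM (- k))).
(* The weights are, up to a common sign, the 2 by 2 minors formed from the vectors (exp (k z), exp
   (- k z)) at z = a, b, 1, that is, the linear relation between three vectors of the plane. *)
have three a b : 0 < a -> 0 < b -> S (1 - b) * w a - S (1 - a) * w b + S (b - a) * w 1 = 0.
  move=> a0 b0; rewrite -mulNr.
  have eB y z : expR (k * (y - z)) = expR (k * y) * expR (- k * z).
    by rewrite -expRD; congr expR; ring.
  have eBN y z : expR (- k * (y - z)) = expR (- k * y) * expR (k * z).
    by rewrite -expRD; congr expR; ring.
  by apply: H => //; rewrite /S !eB !eBN;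
    move: (expR _) (expR _) (expR _) (expR _) (expR _) (expR _) => *; ring.
exists (w 1 / S 1) => x; rewrite /Rplus/= le_eqVlt => /orP[/eqP <-|x0].
  by rewrite w0 -/(S 0) S0 mulr0.
(* This is [three] with b = x. Its point [a] has to be positive, so the boundary value w(0) = 0
   enters as [a] tends to 0 from the right. *)
pose g a := S (1 - x) * w a - S (1 - a) * w x + S (x - a) * w 1.
have Rp0 : Rplus R 0 by exact: lexx.
have Lg : g a @[a --> 0^'+] --> S (1 - x) * w 0 - S (1 - 0) * w x + S (x - 0) * w 1.
  have cid : a @[a --> (0:R)^'+] --> (0 : R) by exact: cvg_at_right_filter.
  have sub c : S (c - a) @[a --> (0:R)^'+] --> S (c - 0).
    apply: (@cvg_comp _ _ _ (fun a => c - a) S); last exact: cS.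
    by apply: cvgB => //; exact: cvg_cst.
  apply: cvgD; last by apply: cvgM; [exact: sub|exact: cvg_cst].
  apply: cvgB; last by apply: cvgM; [exact: sub|exact: cvg_cst].
  apply: cvgM; first exact: cvg_cst.
  apply: cvg_trans (cw 0 Rp0); apply: cvg_app; apply: within_subset => y.
  exact: ltW.
have g0 : \forall a \near (0:R)^'+, g a = 0.
  by near=> a; apply: three => //; near: a; exact: nbhs_right_gt.
have L0 : g a @[a --> 0^'+] --> (0 : R).
  apply: (cvg_trans (near_eq_cvg _) (cvg_cst 0)); near=> a; apply/esym; near: a; exact: g0.
have : S (1 - x) * w 0 - S (1 - 0) * w x + S (x - 0) * w 1 = 0.
  by rewrite -(cvg_lim (@Rhausdorff R) Lg) (cvg_lim (@Rhausdorff R) L0).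
rewrite w0 mulr0 !subr0 sub0r => /eqP; rewrite addrC subr_eq0 => /eqP E.
by apply: (mulfI S1); rewrite -E -/(S x); field.
Unshelve. all: by end_near. Qed.

(** * Verification of the formula, and uniqueness for both notions of solution *)

Section InitialBoundaryValueProblem.
Variables (R : realType) (gamma : R) (T : \bar R) (u0 g : R -> R).
Let mu := @lebesgue_measure R.
Hypotheses (gamma_gt0 : 0 < gamma) (T_gt0 : (0 < T)%E).
Hypotheses (u0_C2b : Ckb 2 (Rplus R) u0) (u0_H2 : H2 u0).
Hypotheses (g_C1 : Ck 1 (time_interval T) g) (u0_0 : u0 0 = 0) (g_0 : g 0 = 0).

Let k := (Num.sqrt gamma)^-1.
Let e (x : R) := expR (- k * x).
Let u (x t : R) := u0 x + g t * e x.

Let k_gt0 : 0 < k. Proof. by rewrite invr_gt0 sqrtr_gt0. Qed.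

Let gammaE : gamma * k ^+ 2 = 1.
Proof. by rewrite exprVn sqr_sqrtr ?ltW// mulfV// gt_eqF. Qed.

Let I0 : time_interval T 0. Proof. by split => //; exact: ltW. Qed.

Let dE (c x : R) : is_derive x 1 (fun x => c * e x) (c * (- k * e x)).
Proof.
have D := is_derive_expM (- k) x.
by apply: is_derive_eq; rewrite /GRing.scale/= /e; ring.
Qed.

Let g_cont : {within time_interval T, continuous g}.
Proof. by have [D [<- [_ cD]]] := g_C1; exact: (cD 0%N). Qed.

Let u_initial x : u x 0 = u0 x. Proof. by rewrite /u g_0 mul0r addr0. Qed.

Let u_boundary t : u 0 t = g t.
Proof. by rewrite /u /e u0_0 mulr0 expR0 mulr1 add0r. Qed.

Let u_continuous t : {within Rplus R, continuous (u^~ t)}.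
Proof.
have [D [D0 [_ cD] _]] := u0_C2b; apply/subspace_continuousP => x x0.
have /subspace_continuousP cu0 := cD 0%N isT; rewrite D0 in cu0.
apply: cvgD; first exact: cu0.
apply: (is_derive_within_cvg (l := g t * (- k * e x))).
exact/is_derive_is_derive_within/dE.
Qed.

(** The increment in time is (g(t) - g(s)) e with a fixed profile e, so continuity in H^2 reduces to
    that of [g]. *)
Let u_C_H2 : C_H2 (time_interval T) u.
Proof.
have [f1 [f2 Hu0]] := u0_H2; have He := H2_exp k_gt0.
exists (fun x t => f1 x + g t * (- k * e x)), (fun x t => f2 x + g t * (k ^+ 2 * e x)).
split; first by move=> t _; exact: H2_with_lin.
move=> s Is; have [Le Le1 Le2 _ _] := He.
have E t : H2norm (fun x => u x t - u x s)
    (fun x => f1 x + g t * (- k * e x) - (f1 x + g s * (- k * e x)))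
    (fun x => f2 x + g t * (k ^+ 2 * e x) - (f2 x + g s * (k ^+ 2 * e x))) =
    `|g t - g s| * H2norm e (fun x => - k * e x) (fun x => k ^+ 2 * e x).
  by rewrite -H2norm_scale//; congr H2norm; apply/funext => x; rewrite /u; ring.
pose K := H2norm e (fun x => - k * e x) (fun x => k ^+ 2 * e x).
have L : `|g t - g s| * K @[t --> within (time_interval T) (nbhs s)] --> (0 : R).
  rewrite -[X in _ --> X](mul0r K).
  apply: cvgM; last exact: cvg_cst.
  move/subspace_continuousP : g_cont => /(_ s Is) cg.
  rewrite -[X in _ --> X](@normr0 _ R) -(subrr (g s)); apply: cvg_norm.
  by apply: cvgB => //; exact: cvg_cst.
by under eq_cvg do rewrite E.
Qed.

Let u_classical : classical_equation gamma T u.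
Proof.
have [D [D0 [DD _] _]] := u0_C2b; have [Dg [Dg0 [DDg _]]] := g_C1.
exists (fun x t => D 1%N x + g t * (- k * e x)),
  (fun x t => D 2%N x + g t * (k ^+ 2 * e x)),
  (fun x t => Dg 1%N t * e x), (fun x t => Dg 1%N t * (k ^+ 2 * e x)).
move=> x t x0 It.
have gt : is_derive_within (time_interval T) g t (Dg 1%N t) by rewrite -Dg0; exact: DDg.
have affine_g a b : is_derive_within (time_interval T) (fun t => a + g t * b) t (Dg 1%N t * b).
  have C0 : is_derive_within (time_interval T) (fun=> a) t 0.
    by apply: is_derive_is_derive_within; exact: is_derive_cst.
  have := is_derive_withinD C0 (is_derive_withinZ (c := b) gt).
  rewrite add0r mulrC; apply: eq_is_derive_within => // y _.
  by rewrite [g y * b]mulrC.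
split.
- apply: is_derive_withinD; first by rewrite -D0; exact: DD.
  exact/is_derive_is_derive_within/dE.
- apply: is_derive_withinD; first exact: DD.
  apply: is_derive_is_derive_within; have D1 := dE (g t * - k) x.
  rewrite (_ : (fun y => _) = fun x => g t * - k * e x).
    by apply: (is_derive_eq D1); ring.
  by apply/funext => y; ring.
- exact: affine_g.
- exact: affine_g.
- by rewrite mulrCA [gamma * _]mulrA gammaE mul1r subrr.
Qed.

Let u_distributional : distributional_equation gamma T u.
Proof.
move=> phi tphi; have [f1 [f2 [Lu0 _ Lf2 _ W2]]] := u0_H2.
have [Le _ Le2 _ We2] := H2_exp k_gt0.
have mR := @measurable_Rplus R.
have Lw : L2plus (fun x => gamma * f2 x - u0 x).
  (* Here - u0 is obtained as u0 + (-2) u0. *)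
  have := L2plus_lin gamma (L2plus_lin (-2) Lu0 Lu0) Lf2.
  by congr L2plus; apply/funext => x; ring.
rewrite -[RHS](Rintegral_test_time tphi Lw); apply: eq_Rintegral => t _.
have tt := test_function2_slice tphi t.
have Lp0 := test_function_L2plus 0 tt; have Lp2 := test_function_L2plus 2 tt.
have Lu : L2plus (u^~ t) by exact: L2plus_lin.
have Lu2 : L2plus (fun x => f2 x + g t * (k ^+ 2 * e x)) by exact: L2plus_lin.
have W := is_weak_derivative_lin (g t) Lu0 Lf2 Le Le2 W2 We2 tt.
rewrite sqrrN expr1n mul1r in W.
have I1 := L2plus_integrableM Lu Lp0; have I2 := L2plus_integrableM Lu Lp2.
have I3 := L2plus_integrableM Lu2 Lp0.
transitivity (gamma * (\int[mu]_(x in Rplus R)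
    (u x t * derive1n 2 (fun x => partial 0 1 phi x t) x)) -
    \int[mu]_(x in Rplus R) (u x t * derive1n 0 (fun x => partial 0 1 phi x t) x)).
  rewrite -(RintegralZl gamma mR I2) -(RintegralB mR (integrableZl_EFin gamma mR I2) I1).
  by apply: eq_Rintegral => x _; rewrite opprB mulrBr mulrCA.
rewrite W -(RintegralZl gamma mR I3) -(RintegralB mR (integrableZl_EFin gamma mR I3) I1).
apply: eq_Rintegral => x _; rewrite derive1n0 /u.
move: (partial 0 1 phi x t) => p.
transitivity ((gamma * f2 x - u0 x) * p + (gamma * k ^+ 2 - 1) * (g t * e x * p)); first ring.
by rewrite gammaE subrr mul0r addr0.
Qed.

Lemma ibvp_difference_L2plus equation v t : ibvp_solution equation T u0 g v ->
  time_interval T t -> L2plus (fun x => v x t - u x t).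
Proof.
move=> [vH _ _ _ _] It.
have := L2plus_lin (-1) (C_H2_L2plus vH It) (C_H2_L2plus u_C_H2 It).
by congr L2plus; apply/funext => x; rewrite mulN1r.
Qed.

Lemma classical_ibvp_solution : is_the_ibvp_solution (classical_equation gamma T) T u0 g u.
Proof.
split; first by split.
move=> v Sv x t x0 It; have [_ _ ve vi vb] := Sv.
have [D [D0 DD _]] := u0_C2b.
(* The same [D] serves for [v] and for [u], so the two conserved quantities have literally the same
   value and cancel in the difference. *)
have [vx [vxx /(_ t It) Hv]] := classical_conservation T_gt0 DD D0 ve vi.
have [ux [uxx /(_ t It) Hu]] := classical_conservation T_gt0 DD D0 u_classical (fun x _ => u_initial x).
apply/eqP; rewrite -subr_eq0; apply/eqP.
pose w x := v x t - u x t.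
have lin f f' h h' y : is_derive_within (Rplus R) f y f' -> is_derive_within (Rplus R) h y h' ->
    Rplus R y -> is_derive_within (Rplus R) (fun x => f x - h x) y (f' - h').
  move=> Df Dh Ry; have := is_derive_withinD Df (is_derive_withinZ (c := -1) Dh).
  by rewrite mulN1r; apply: eq_is_derive_within => // z _; rewrite mulN1r.
have W := @hyperbolic_ode _ w (fun x => vx x t - ux x t) (fun x => vxx x t - uxx x t) k k_gt0.
apply: (L2plus_hyperbolic_eq0 k_gt0 (ibvp_difference_L2plus Sv It) (W _ _ _ _)) => //.
- by move=> y Ry; have [d1 _ _] := Hv y Ry; have [d2 _ _] := Hu y Ry; exact: lin.
- by move=> y Ry; have [_ d1 _] := Hv y Ry; have [_ d2 _] := Hu y Ry; exact: lin.
- move=> y Ry; have [_ _ d1] := Hv y Ry; have [_ _ d2] := Hu y Ry.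
  have E : v y t - u y t = gamma * (vxx y t - uxx y t) by lra.
  by rewrite /w E mulrA [k ^+ 2 * _]mulrC gammaE mul1r.
- by rewrite /w vb// u_boundary subrr.
Qed.

Lemma distributional_ibvp_solution : is_the_ibvp_solution (distributional_equation gamma T) T u0 g u.
Proof.
split; first by split.
move=> v Sv x t x0 It; have [vH vc ve vi vb] := Sv.
have [M [sM M_ge0 M0 M1]] := smooth_step_exists R.
apply/eqP; rewrite -subr_eq0; apply/eqP.
have Rp0 : Rplus R 0 by exact: lexx.
have [||||C HC] := @hyperbolic_interpolation R (fun x => v x t - u x t) k.
- exact: k_gt0.
- move=> y; apply: cvgB; [exact: vc|exact: u_continuous].
- by rewrite vb// u_boundary subrr.
- move=> a1 a2 a3 c1 c2 c3 a10 a20 a30 Cp Cm.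
  have Ev := combination_conserved T_gt0 vH sM M_ge0 M0 M1 ve k_gt0 gammaE vc It a10 a20 a30 Cp Cm.
  have Eu := combination_conserved T_gt0 u_C_H2 sM M_ge0 M0 M1 u_distributional k_gt0 gammaE
    (fun t _ => @u_continuous t) It a10 a20 a30 Cp Cm.
  rewrite !u_initial in Eu; rewrite !vi ?/Rplus/= ?ltW// -Eu in Ev.
  by rewrite !mulrBr; lra.
exact: (L2plus_hyperbolic_eq0 k_gt0 (ibvp_difference_L2plus Sv It) HC).
Qed.

End InitialBoundaryValueProblem.

Theorem corollary2p2 (R : realType) (gamma : R) (T : \bar R) (u0 g : R -> R)
    (gamma_gt0 : 0 < gamma) (T_gt0 : (0 < T)%E)
    (u0_C2b : Ckb 2 (Rplus R) u0) (u0_H2 : H2 u0)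
    (g_C1 : Ck 1 (time_interval T) g)
    (u0_0 : u0 0 = 0) (g_0 : g 0 = 0) :
  let u := fun x t : R => u0 x + g t * expR (- (x / Num.sqrt gamma)) in
  is_the_ibvp_solution (classical_equation gamma T) T u0 g u /\
  is_the_ibvp_solution (distributional_equation gamma T) T u0 g u.
Proof.
move=> u.
have -> : u = fun x t => u0 x + g t * expR (- (Num.sqrt gamma)^-1 * x).
  by apply/funext => x; apply/funext => t; rewrite /u mulNr [x / _]mulrC.
by split; [exact: classical_ibvp_solution|exact: distributional_ibvp_solution].
Qed.
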